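(* Let $\mathcal{B}$ be a $C^*$-algebra and let $E$ be a Hilbert $\mathcal{B}$-module. For a subset $K\subset E$ the following conditions are equivalent: 1. $K$ is an ideal submodule of $E$. 2. $K$ is a closed ternary ideal in $E$. 3. $K$ is a closed linking ideal in $E$.
   Context: Hilbert modules are right modules with $\mathcal{B}$-valued inner product $\langle\cdot,\cdot\rangle$, linear in the second variable; they need not be full. Products of sets are just sets of products of elements; $\overline{\mathrm{span}}$ denotes closed linear span. For $x\in E$, $x^*\colon y\mapsto\langle x,y\rangle$, and $xy^*$ is the rank-one operator $z\mapsto x\langle y,z\rangle$; $K^*=\{x^*:x\in K\}$; $\mathscr{K}(E)=\overline{\mathrm{span}}\,EE^*$ is the algebra of compact operators. The range ideal of $E$ is $\mathcal{B}_E=\overline{\mathrm{span}}\,\langle E,E\rangle$. The reduced linking algebra of $E$ is the $C^*$-algebra $\mathscr{K}\begin{pmatrix}\mathcal{B}_E \\ E\end{pmatrix}=\begin{pmatrix}\mathcal{B}_E & E^* \\ E & \mathscr{K}(E)\end{pmatrix}$ (compact operators on the Hilbert module $\mathcal{B}_E\oplus E$). Definitions: $K\subset E$ is an ideal submodule if $K=\overline{\mathrm{span}}\,EI$ for some closed ideal $I$ in $\mathcal{B}$. A linear subspace $K\subset E$ is a ternary ideal if $E\langle K,E\rangle\subset K$. A subset $K\subset E$ is a linking ideal if $\begin{pmatrix}\overline{\mathrm{span}}\,\langle K,K\rangle & K^* \\ K & \overline{\mathrm{span}}\,KK^*\end{pmatrix}$ is a (two-sided) ideal in the reduced linking algebra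 of $E$. *)

(* Defs.v *)
From HB Require Import structures.
From mathcomp Require Import all_boot all_order all_algebra complex.
From mathcomp Require Import all_classical all_reals all_analysis.

Set Implicit Arguments.
Unset Strict Implicit.
Unset Printing Implicit Defensive.

Import Order.TTheory GRing.Theory Num.Theory.
Import numFieldNormedType.Exports.
Local Open Scope classical_set_scope.
Local Open Scope ring_scope.
Local Open Scope complex_scope.

(* Complex C*-algebras, not assumed unital: MathComp's ring structures all have
   a unit, hence the separate product [cmul]. *)
HB.mixin Record isCStarAlgebra (R : realType) B
    of CompleteNormedModule R[i] B := {
  cmul : B -> B -> B;
  star : B -> B;
  cmulA : forall a b c, cmul a (cmul b c) = cmul (cmul a b) c;
  cmulDl : forall a b c, cmul (a + b) c = cmul a c + cmul b c;
  cmulDr : forall a b c, cmul a (b + c) = cmul a b + cmul a c;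
  cmulZl : forall (k : R[i]) a b, cmul (k *: a) b = k *: cmul a b;
  cmulZr : forall (k : R[i]) a b, cmul a (k *: b) = k *: cmul a b;
  starK : forall a, star (star a) = a;
  starD : forall a b, star (a + b) = star a + star b;
  starZ : forall (k : R[i]) a, star (k *: a) = Num.conj k *: star a;
  starM : forall a b, star (cmul a b) = cmul (star b) (star a);
  normM_le : forall a b, `|cmul a b| <= `|a| * `|b|;
  norm_starM : forall a, `|cmul (star a) a| = `|a| ^+ 2
}.

#[short(type="cstarAlgType")]
HB.structure Definition CStarAlgebra (R : realType) :=
  {B of isCStarAlgebra R B & CompleteNormedModule R[i] B}.

Notation "a ** b" := (cmul a b) (at level 40, left associativity) : ring_scope.

(* The purely algebraic part of the structure of a Hilbert [B]-module. *)
HB.mixin Record isInnerProductModule (R : realType) (B : cstarAlgType R) E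
    of GRing.Lmodule R[i] E := {
  act : E -> B -> E;
  ip : E -> E -> B;
  actDl : forall x y a, act (x + y) a = act x a + act y a;
  actDr : forall x a b, act x (a + b) = act x a + act x b;
  actZl : forall (k : R[i]) x a, act (k *: x) a = k *: act x a;
  actZr : forall (k : R[i]) x a, act x (k *: a) = k *: act x a;
  actA : forall x a b, act x (a ** b) = act (act x a) b;
  ipDr : forall x y z, ip x (y + z) = ip x y + ip x z;
  ipZr : forall (k : R[i]) x y, ip x (k *: y) = k *: ip x y;
  ip_act : forall x y a, ip x (act y a) = ip x y ** a;
  ip_star : forall x y, star (ip x y) = ip y x
}.

#[short(type="innerProductModType")]
HB.structure Definition InnerProductModule (R : realType)
    (B : cstarAlgType R) :=
  {E of isInnerProductModule R B E & GRing.Lmodule R[i] E}.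

(* The norm of a Hilbert module is x |-> `|<x, x>|^(1/2); that it is a norm is
   a consequence of the other axioms, so that asking for a complete normed
   module with this norm is no restriction.  Definiteness of the inner product
   is contained in [hilbert_norm]. *)
HB.mixin Record isHilbertModule (R : realType) (B : cstarAlgType R) E
    of InnerProductModule R B E & CompleteNormedModule R[i] E := {
  ip_pos : forall x : E, exists c : B, ip x x = star c ** c;
  hilbert_norm : forall x : E, `|x| = sqrtC `|ip x x : B|
}.

#[short(type="hilbertModType")]
HB.structure Definition HilbertModule (R : realType) (B : cstarAlgType R) :=
  {E of isHilbertModule R B E & InnerProductModule R B E
      & CompleteNormedModule R[i] E}.

Section Subspaces.
Context {R : realType}.

Definition is_subspace (V : lmodType R[i]) (K : set V) :=
  K 0 /\ forall (k : R[i]) x y, K x -> K y -> K (k *: x + y).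

Definition linspan (V : lmodType R[i]) (A : set V) : set V :=
  [set v | exists n (k : 'I_n -> R[i]) (x : 'I_n -> V),
     (forall i, A (x i)) /\ v = \sum_(i < n) k i *: x i].

Definition cspan (V : normedModType R[i]) (A : set V) : set V :=
  closure (linspan A).

(* [mul] is the product of the algebra of which [A] is a subalgebra. *)
Definition is_ideal (V : lmodType R[i]) (mul : V -> V -> V) (A J : set V) :=
  [/\ J `<=` A, is_subspace J
    & forall a j, A a -> J j -> J (mul a j) /\ J (mul j a)].

Lemma linspan_subspace (V : lmodType R[i]) (A : set V) :
  is_subspace (linspan A).
Proof.
split.
  exists 0, (fun=> 0), (fun=> 0); split; first by case.
  by rewrite big_ord0.
move=> k _ _ [n [c [x [Ax ->]]]] [m [d [y [Ay ->]]]].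
exists (n + m)%N, (fun i : 'I_(n + m) => match fintype.split i with inl j => k * c j | inr j => d j end).
exists (fun i : 'I_(n + m) => match fintype.split i with inl j => x j | inr j => y j end); split.
  by move=> i; case: (fintype.split i).
rewrite big_split_ord /= scaler_sumr; congr (_ + _); apply: eq_bigr => i _.
  by rewrite (unsplitK (inl i)) scalerA.
by rewrite (unsplitK (inr i)).
Qed.

Lemma sub_linspan (V : lmodType R[i]) (A : set V) : A `<=` linspan A.
Proof.
move=> a Aa; exists 1, (fun=> 1), (fun=> a); split=> //.
by rewrite big_ord1 scale1r.
Qed.

Lemma closureP (V : normedModType R[i]) (A : set V) (v : V) :
  closure A v <-> forall e : R[i], 0 < e -> exists2 a, A a & `|v - a| < e.
Proof.
split=> [Av e e0|Av U /nbhs_ballP[e /= e0 veU]].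
  have [a [Aa]] := Av _ (nbhsx_ballx v e e0).
  by rewrite -ball_normE => va; exists a.
have [a Aa va] := Av e e0.
by exists a; split => //; apply: veU; rewrite -ball_normE.
Qed.

Lemma closure_subspace (V : normedModType R[i]) (K : set V) :
  is_subspace K -> is_subspace (closure K).
Proof.
move=> [K0 KD]; split; first exact: subset_closure.
move=> k x y /closureP Kx /closureP Ky; apply/closureP => e e0.
have k1 : 0 < `|k| + 1 by rewrite ltr_wpDl.
have [a Ka xa] := Kx (e / 2 / (`|k| + 1)) ltac:(by rewrite !divr_gt0).
have [b Kb yb] := Ky (e / 2) ltac:(by rewrite divr_gt0).
exists (k *: a + b); first exact: KD.
rewrite opprD addrACA -scalerBr (le_lt_trans (ler_normD _ _))//.
rewrite (splitr e) ler_ltD// normrZ.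
rewrite (@le_trans _ _ ((`|k| + 1) * `|x - a|))//.
  by rewrite ler_wpM2r// lerDl.
by rewrite mulrC -ler_pdivlMr// ltW.
Qed.

End Subspaces.

Section Operators.
Context {R : realType} {B : cstarAlgType R}.

Definition mod_norm (F : innerProductModType B) (u : F) : R[i] :=
  sqrtC `|ip u u : B|.

(* Closure in operator norm. A limit of bounded linear operators in this sense
   is a bounded linear operator, so [T] may range over all maps. *)
Definition op_closure (F : innerProductModType B) (A : set (F -> F)) :
    set (F -> F) :=
  [set T | forall e : R[i], 0 < e ->
     exists2 S, A S & forall u, mod_norm (T u - S u) <= e * mod_norm u].

Definition rank1 (F : innerProductModType B) (u v : F) : F -> F :=
  fun z => act u (ip v z).

(* The closed linear span of [K K^*]. *)
Definition rank1_cspan (F : innerProductModType B) (K : set F) : set (F -> F) :=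
  op_closure (linspan [set T | exists u v, [/\ K u, K v & T = rank1 u v]]).

Definition compact_op (F : innerProductModType B) : set (F -> F) :=
  rank1_cspan [set: F].

End Operators.

Section RangeIdeal.
Context {R : realType} {B : cstarAlgType R} (E : hilbertModType B).

Definition ip_set (K L : set E) : set B :=
  [set b | exists x y, [/\ K x, L y & b = ip x y]].

Definition act_set (K : set E) (I : set B) : set E :=
  [set z | exists x a, [/\ K x, I a & z = act x a]].

Definition range_set : set B := cspan (ip_set [set: E] [set: E]).

Lemma range_set_subspace : is_subspace range_set.
Proof. exact/closure_subspace/linspan_subspace. Qed.

Lemma range_set_ip (x y : E) : range_set (ip x y).
Proof. by apply/subset_closure/sub_linspan; exists x, y. Qed.

Lemma cmul0l (a : B) : 0 ** a = 0.
Proof. by rewrite -[X in X ** _](scale0r (0 : B)) cmulZl scale0r. Qed.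

Lemma cmul_suml n (b : 'I_n -> B) (a : B) :
  (\sum_(i < n) b i) ** a = \sum_(i < n) b i ** a.
Proof.
elim: n b => [|n IH] b; first by rewrite !big_ord0 cmul0l.
by rewrite !big_ord_recl cmulDl IH.
Qed.

Lemma range_set_mulr (b a : B) : range_set b -> range_set (b ** a).
Proof.
move=> /closureP Eb; apply/closureP => e e0.
have a1 : 0 < `|a| + 1 by rewrite ltr_wpDl.
have [_ [n [k [x [Ex ->]]]] bx] := Eb (e / (`|a| + 1)) ltac:(by rewrite divr_gt0).
set s := \sum_(i < n) _ in bx; exists (s ** a).
  exists n, k, (fun i => x i ** a); split.
    move=> i; have [y [z [_ _ ->]]] := Ex i.
    by exists y, (act z a); rewrite ip_act.
  by rewrite cmul_suml; apply: eq_bigr => i _; rewrite cmulZl.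
have -> : b ** a - s ** a = (b - s) ** a.
  by rewrite cmulDl -[- s]scaleN1r cmulZl scaleN1r.
rewrite (le_lt_trans (normM_le _ _))//.
rewrite (@le_lt_trans _ _ (`|b - s| * (`|a| + 1)))//.
  by rewrite ler_wpM2l// lerDl.
by rewrite -ltr_pdivlMr.
Qed.

Definition range_pred : {pred B} := fun b => `[< range_set b >].

Lemma range_pred_submod : submod_closed range_pred.
Proof.
have [r0 rD] := range_set_subspace.
split; first exact/asboolP.
by move=> k x y /asboolP rx /asboolP ry; apply/asboolP/rD.
Qed.

HB.instance Definition _ :=
  GRing.isSubmodClosed.Build R[i] B range_pred range_pred_submod.

Definition range_ideal := {b : B | b \in range_pred}.
HB.instance Definition _ := SubChoice.on range_ideal.
HB.instance Definition _ := [SubChoice_isSubLmodule of range_ideal by <:].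

Lemma range_mul_proof (b : range_ideal) (a : B) : val b ** a \in range_pred.
Proof. by apply/asboolP/range_set_mulr/asboolP/(valP b). Qed.

Definition range_mul (b : range_ideal) (a : B) : range_ideal :=
  Sub (val b ** a) (range_mul_proof b a).

Lemma range_ip_proof (x y : E) : ip x y \in range_pred.
Proof. exact/asboolP/range_set_ip. Qed.

Definition range_ip (x y : E) : range_ideal := Sub (ip x y) (range_ip_proof x y).

(* The Hilbert module B_E (+) E. *)
Definition range_sum := (range_ideal * E)%type.
HB.instance Definition _ := GRing.Lmodule.on range_sum.

Definition sum_act (u : range_sum) (a : B) : range_sum :=
  (range_mul u.1 a, act u.2 a).

Definition sum_ip (u v : range_sum) : B :=
  star (val u.1) ** val v.1 + ip u.2 v.2.

Lemma sum_actDl x y a : sum_act (x + y) a = sum_act x a + sum_act y a.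
Proof.
congr pair; last exact: actDl.
by apply: val_inj; rewrite /= cmulDl.
Qed.

Lemma sum_actDr x a b : sum_act x (a + b) = sum_act x a + sum_act x b.
Proof.
congr pair; last exact: actDr.
by apply: val_inj; rewrite /= cmulDr.
Qed.

Lemma sum_actZl (k : R[i]) x a : sum_act (k *: x) a = k *: sum_act x a.
Proof.
congr pair; last exact: actZl.
by apply: val_inj; rewrite /= cmulZl.
Qed.

Lemma sum_actZr (k : R[i]) x a : sum_act x (k *: a) = k *: sum_act x a.
Proof.
congr pair; last exact: actZr.
by apply: val_inj; rewrite /= cmulZr.
Qed.

Lemma sum_actA x a b : sum_act x (a ** b) = sum_act (sum_act x a) b.
Proof.
congr pair; last exact: actA.
by apply: val_inj; rewrite /= cmulA.
Qed.

Lemma sum_ipDr x y z : sum_ip x (y + z) = sum_ip x y + sum_ip x z.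
Proof. by rewrite /sum_ip /= cmulDr ipDr addrACA. Qed.

Lemma sum_ipZr (k : R[i]) x y : sum_ip x (k *: y) = k *: sum_ip x y.
Proof. by rewrite /sum_ip /= cmulZr ipZr scalerDr. Qed.

Lemma sum_ip_act x y a : sum_ip x (sum_act y a) = sum_ip x y ** a.
Proof. by rewrite /sum_ip /= cmulA ip_act cmulDl. Qed.

Lemma sum_ip_star x y : star (sum_ip x y) = sum_ip y x.
Proof. by rewrite /sum_ip starD starM starK ip_star. Qed.

HB.instance Definition _ := isInnerProductModule.Build R B range_sum
  sum_actDl sum_actDr sum_actZl sum_actZr sum_actA
  sum_ipDr sum_ipZr sum_ip_act sum_ip_star.

(* The operator matrix with rows (b, <x, _>) and (y, k). *)
Definition block_op (b : range_ideal) (x y : E) (k : E -> E) :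
    range_sum -> range_sum :=
  fun u => (range_mul b (val u.1) + range_ip x u.2, act y (val u.1) + k u.2).

Definition linking_algebra : set (range_sum -> range_sum) :=
  @compact_op R B range_sum.

Definition linking_set (K : set E) : set (range_sum -> range_sum) :=
  [set T | exists b x y k,
     [/\ cspan (ip_set K K) (val b), K x, K y, rank1_cspan K k
       & T = block_op b x y k]].

Definition ideal_submodule (K : set E) :=
  exists I : set B,
    [/\ is_ideal (@cmul R B) [set: B] I, closed I
      & K = cspan (act_set [set: E] I)].

Definition ternary_ideal (K : set E) :=
  is_subspace K /\ forall x y z : E, K y -> K (act x (ip y z)).

Definition linking_ideal (K : set E) :=
  is_ideal (fun S T : range_sum -> range_sum => S \o T)
    linking_algebra (linking_set K).

End RangeIdeal.

(* Main.v *)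
Require Import Defs.
From HB Require Import structures.
From mathcomp Require Import all_boot all_order all_algebra complex.
From mathcomp Require Import all_classical all_reals all_analysis.
From mathcomp Require Import ring lra.

Set Implicit Arguments.
Unset Strict Implicit.
Unset Printing Implicit Defensive.

Import Order.TTheory GRing.Theory Num.Theory.
Import numFieldNormedType.Exports.
Local Open Scope classical_set_scope.
Local Open Scope ring_scope.
Local Open Scope complex_scope.

(** Positivity is handled without spectral theory. A bounded operator [T] on the
    algebra is called accretive if [|c| <= |c + t T c|] for all [c] and all
    [t >= 0]; sums of accretive operators are accretive, and so is the square of
    a symmetric operator, because [|c + i T c| = |c - i T c|] by the C*-identity.
    Kaplansky's argument, applied to the elements [a f(a^* a)] for polynomials
    [f], then shows that [c |-> c - a^* a c] is a contraction when [|a| <= 1].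
    There are two consequences. First, [|a|^2] is bounded by a multiple of
    [|a^* a + c^* c|], so that the norm of [B_E (+) E] is equivalent to the sum
    of the norms. Secondly, [x] is the limit of elements [x <x, x'>] in which
    [x'] is a polynomial in the operator [y |-> x <x, y>] applied to [x].

    The approximation [x ~ x <x, x'>] replaces approximate units. It shows that
    [E I] is a ternary ideal and that a closed ternary ideal [K] is
    [E I] for [I] the closed span of [<K, K>]. The linking set of such a [K] is
    closed, and it is the closed span of the operators [u v^*] with [u, v] in
    [I (+) K]; as it contains [u v^*] as soon as one of [u], [v] lies there, it is
    an ideal. Conversely, if [K] is a linking ideal and [k] is in [K], then
    the corners [k^*], [x <x, x'>] and [z <z, z'>] multiply to
    [x <x, x'> <k, z <z, z'>>], which is therefore in [K], and
    [x <k, z>] is a limit of such elements. *)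

(* The square-zero extension of a module: its commutative ring structure makes
   [ring] decide identities between linear combinations. *)
Section SquareZero.
Context {K : comNzRingType} {V : lmodType K}.

Definition sqz := (K * V)%type.
HB.instance Definition _ := GRing.Zmodule.on sqz.

Definition sqz_mul (x y : sqz) : sqz := (x.1 * y.1, x.1 *: y.2 + y.1 *: x.2).

Fact sqz_mulA : associative sqz_mul.
Proof.
move=> x y z; rewrite /sqz_mul /= mulrA !scalerDr !scalerA addrA.
by congr (_, _ + _ + _); rewrite ?[z.1 * _]mulrC // mulrC.
Qed.

Fact sqz_mulC : commutative sqz_mul.
Proof. by move=> x y; rewrite /sqz_mul mulrC addrC. Qed.

Fact sqz_mul1 : left_id ((1, 0) : sqz) sqz_mul.
Proof. by case=> k v; rewrite /sqz_mul /= mul1r scale1r scaler0 addr0. Qed.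

Fact sqz_mulDl : left_distributive sqz_mul +%R.
Proof.
move=> x y z; rewrite /sqz_mul /= mulrDl scalerDl scalerDr addrACA.
by congr pair.
Qed.

Fact sqz_1_neq0 : ((1, 0) : sqz) != 0.
Proof. by rewrite xpair_eqE oner_eq0. Qed.

HB.instance Definition _ := GRing.Zmodule_isComNzRing.Build sqz
  sqz_mulA sqz_mulC sqz_mul1 sqz_mulDl sqz_1_neq0.

Definition in_sqz (v : V) : sqz := (0, v).
Definition scalar_sqz (k : K) : sqz := (k, 0).

Fact in_sqz_is_additive : zmod_morphism in_sqz.
Proof. by move=> x y; rewrite /in_sqz; congr pair; rewrite subr0. Qed.
HB.instance Definition _ :=
  GRing.isZmodMorphism.Build V sqz in_sqz in_sqz_is_additive.

Fact scalar_sqz_is_additive : zmod_morphism scalar_sqz.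
Proof. by move=> x y; rewrite /scalar_sqz; congr pair; rewrite subr0. Qed.
HB.instance Definition _ :=
  GRing.isZmodMorphism.Build K sqz scalar_sqz scalar_sqz_is_additive.

Fact scalar_sqz_is_monoid_morphism : monoid_morphism scalar_sqz.
Proof.
split=> // x y; rewrite /scalar_sqz; congr pair.
by rewrite /= !scaler0 addr0.
Qed.
HB.instance Definition _ := GRing.isMonoidMorphism.Build K sqz scalar_sqz
  scalar_sqz_is_monoid_morphism.

Lemma in_sqzZ k v : in_sqz (k *: v) = scalar_sqz k * in_sqz v.
Proof. by rewrite /in_sqz /scalar_sqz; congr pair; rewrite /= ?mulr0 // scale0r addr0. Qed.

Lemma in_sqzD v w : in_sqz (v + w) = in_sqz v + in_sqz w.
Proof. exact: raddfD. Qed.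
Lemma in_sqzN v : in_sqz (- v) = - in_sqz v.
Proof. exact: raddfN. Qed.
Lemma in_sqz0 : in_sqz 0 = 0.
Proof. exact: raddf0. Qed.
Lemma in_sqzMn v n : in_sqz (v *+ n) = n%:R * in_sqz v.
Proof. by rewrite raddfMn mulr_natl. Qed.

Lemma in_sqz_inj : injective in_sqz.
Proof. by move=> x y []. Qed.

End SquareZero.

Ltac lin := apply: in_sqz_inj;
  rewrite ?(in_sqzD, in_sqzN, in_sqz0, in_sqzMn, in_sqzZ); ring.

Section RealNorm.
Context {R : realType}.

Definition nr (V : normedModType R[i]) (x : V) : R := complex.Re `|x|.

Lemma normE (V : normedModType R[i]) (x : V) : `|x| = (nr x)%:C.
Proof. by rewrite /nr RRe_real // ger0_real. Qed.

Lemma ltr0C (x : R) : (0 < x%:C) = (0 < x).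
Proof. by rewrite ltcR. Qed.

Lemma gt0C (e : R[i]) : 0 < e -> exists2 d : R, 0 < d & e = d%:C.
Proof.
move=> e0; exists (complex.Re e); last by rewrite RRe_real // gtr0_real.
by rewrite -ltr0C RRe_real // gtr0_real.
Qed.

Section Fixed.
Context {V : normedModType R[i]}.
Implicit Types x y : V.

Lemma nr_ge0 x : 0 <= nr x.
Proof. by rewrite -ler0c -normE. Qed.

Lemma nr0 : nr (0 : V) = 0.
Proof. by rewrite /nr normr0. Qed.

Lemma nr0_eq0 x : nr x = 0 -> x = 0.
Proof. by move=> x0; apply/normr0_eq0; rewrite normE x0. Qed.

Lemma nrN x : nr (- x) = nr x.
Proof. by rewrite /nr normrN. Qed.

Lemma nrD x y : nr (x + y) <= nr x + nr y.
Proof. by rewrite -lecR rmorphD /= -!normE ler_normD. Qed.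

Lemma nrB x y : nr (x - y) <= nr x + nr y.
Proof. by rewrite -(nrN y) nrD. Qed.

Lemma nrZ (k : R[i]) x : nr (k *: x) = complex.Re `|k| * nr x.
Proof.
by rewrite /nr normrZ; case: `|k| (ger0_Im (normr_ge0 k)) => a b /= ->; case: `|x| => c d /=; rewrite mul0r subr0.
Qed.

Lemma nrZr (t : R) x : nr (t%:C *: x) = `|t| * nr x.
Proof. by rewrite nrZ normc_def /= expr0n /= addr0 sqrtr_sqr. Qed.

Lemma nrZp (t : R) x : 0 <= t -> nr (t%:C *: x) = t * nr x.
Proof. by move=> t0; rewrite nrZr ger0_norm. Qed.

Lemma nr_sum n (f : 'I_n -> V) : nr (\sum_i f i) <= \sum_i nr (f i).
Proof.
elim/big_rec2: _ => [|i y x _ le]; first by rewrite nr0.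
by rewrite (le_trans (nrD _ _)) // lerD2l.
Qed.

End Fixed.
End RealNorm.

Lemma le_addeM (R : realType) (x y C d : R) : 0 < d -> 0 <= C ->
  (forall e, 0 < e -> e < d -> x <= y + C * e) -> x <= y.
Proof.
move=> d0 C0 H; apply/ler_addgt0Pr => e e0.
have C1 : 0 < C + 1 by lra.
set m := Num.min (d / 2) (e / (C + 1)).
have m0 : 0 < m by rewrite /m lt_min !divr_gt0.
have md : m < d by rewrite /m gt_min; apply/orP; left; lra.
apply: (le_trans (H m m0 md)); rewrite lerD2l.
have me : m <= e / (C + 1) by rewrite /m ge_min lexx orbT.
rewrite ler_pdivlMr // in me; nra.
Qed.

Section Accretive.
Context {R : realType} {V : normedModType R[i]}.
Implicit Types S T : V -> V.

(* For a symmetric operator on a C*-algebra this amounts to positivity. *)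
Definition accretive T := forall (t : R) c, 0 <= t -> nr c <= nr (c + t%:C *: T c).

(* By convexity it is enough to know the inequality to first order at [t = 0]. *)
Lemma accretive_small T :
  (forall c, exists2 C : R, 0 <= C
     & forall e : R, 0 < e -> nr c <= nr (c + e%:C *: T c) + C * e ^+ 2) ->
  accretive T.
Proof.
move=> TC t c; rewrite le_eqVlt => /predU1P[<-|t0].
  by rewrite scale0r addr0.
have [C C0 H] := TC c; set d := c + t%:C *: T c.
apply: (@le_addeM _ _ _ (C * t) t) => // [|e e0 et]; first by rewrite mulr_ge0 // ltW.
have := H e e0.
have -> : c + e%:C *: T c = (1 - e / t)%:C *: c + (e / t)%:C *: d.
  have -> : e%:C *: T c = (e / t)%:C *: (t%:C *: T c).
    by rewrite scalerA -rmorphM /= divfK // gt_eqF.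
  by rewrite /d; lin.
have et1 : e / t < 1 by rewrite ltr_pdivrMr // mul1r.
have et0 : 0 < e / t by rewrite divr_gt0.
move=> /le_trans/(_ (lerD (nrD _ _) (lexx _))).
rewrite !nrZp; try lra.
move=> le_cd; have Ce : e / t * (C * t * e) = C * e ^+ 2 by field; rewrite gt_eqF.
by rewrite -(@ler_pM2l _ (e / t)) // mulrDr Ce; lra.
Qed.

Lemma accretive_add S T : linear S -> accretive S -> accretive T ->
  accretive (fun c => S c + T c).
Proof.
move=> Sl aS aT; apply: accretive_small => c.
exists (nr (S (T c))); first exact: nr_ge0.
move=> e e0.
have := aT e c (ltW e0); have := aS e (c + e%:C *: T c) (ltW e0).
have -> : S (c + e%:C *: T c) = S c + e%:C *: S (T c).
  by rewrite addrC Sl addrC.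
have -> : c + e%:C *: T c + e%:C *: (S c + e%:C *: S (T c)) =
  c + e%:C *: (S c + T c) + (e ^+ 2)%:C *: S (T c) by rewrite rmorphXn /=; lin.
move=> /le_trans/(_ (nrD _ _)).
rewrite nrZp ?sqr_ge0 // [_ * nr _]mulrC; lra.
Qed.

Lemma accretive_scale T (r : R) : 0 <= r -> accretive T ->
  accretive (fun c => r%:C *: T c).
Proof.
move=> r0 aT t c t0; rewrite scalerA -rmorphM /=.
by apply: aT; rewrite mulr_ge0.
Qed.

Lemma eq_accretive S T : S =1 T -> accretive S -> accretive T.
Proof. by move=> ST aS t c t0; rewrite -ST aS. Qed.

Lemma accretive_limit T :
  (forall c, exists2 C : R, 0 <= C & forall e : R, 0 < e ->
     exists2 S, accretive S & nr (S c - T c) <= C * e) ->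
  accretive T.
Proof.
move=> H t c t0; have [C C0 HC] := H c.
apply: (@le_addeM _ _ _ (t * C) 1) => // [|e e0 _]; first by rewrite mulr_ge0.
have [S aS ST] := HC e e0.
apply: (le_trans (aS t c t0)).
have -> : c + t%:C *: S c = (c + t%:C *: T c) + t%:C *: (S c - T c) by lin.
by apply: (le_trans (nrD _ _)); rewrite lerD2l nrZp // -mulrA ler_wpM2l.
Qed.

Lemma accretive_lower_bound T (r t : R) c : 0 < r -> 0 <= t -> accretive T ->
  r * nr c <= nr (r%:C *: c + t%:C *: T c).
Proof.
move=> r0 t0 aT.
have -> : r%:C *: c + t%:C *: T c = r%:C *: (c + (t / r)%:C *: T c).
  rewrite scalerDr scalerA -rmorphM /= mulrCA mulfV ?mulr1 //.
  by rewrite gt_eqF.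
rewrite nrZp ?(ltW r0) //; by rewrite ler_pM2l // aT // divr_ge0 // ltW.
Qed.

Lemma accretive_bound T (r : R) : (forall c, nr (T c) <= r * nr c) ->
  accretive (fun c => r%:C *: c - T c).
Proof.
move=> Tr t c t0.
have -> : c + t%:C *: (r%:C *: c - T c) = (1 + t * r)%:C *: c - t%:C *: T c.
  by rewrite rmorphD rmorphM /=; lin.
have rt : t * nr (T c) <= t * (r * nr c) by rewrite ler_wpM2l.
have := nrD ((1 + t * r)%:C *: c - t%:C *: T c) (t%:C *: T c).
rewrite subrK (nrZp _ t0) nrZr.
have := ler_wpM2r (nr_ge0 c) (ler_norm (1 + t * r)); lra.
Qed.

End Accretive.

Section PolynomialCalculus.
Context {R : realType} {V : lmodType R[i]} (T : {linear V -> V}).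
Implicit Types p q : {poly R}.

Definition pop p (c : V) : V := \sum_(i < size p) (p`_i)%:C *: iter i T c.

Lemma pop_wide n p c : (size p <= n)%N ->
  pop p c = \sum_(i < n) (p`_i)%:C *: iter i T c.
Proof.
move=> pn; rewrite /pop (big_ord_widen n (fun i => (p`_i)%:C *: iter i T c)) //.
rewrite big_mkcond; apply: eq_bigr => i _; case: ltnP => // pi.
by rewrite nth_default // scale0r.
Qed.

Lemma pop_is_linear p : linear (pop p).
Proof.
move=> k x y; rewrite /pop scaler_sumr -big_split; apply: eq_bigr => i _ /=.
have -> : iter i T (k *: x + y) = k *: iter i T x + iter i T y.
  by elim: (i : nat) => //= n ->; rewrite linearP.
by lin.
Qed.
HB.instance Definition _ p := GRing.isLinear.Build R[i] V V *:%R (pop p)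
  (pop_is_linear p).

Lemma popD p q c : pop (p + q) c = pop p c + pop q c.
Proof.
rewrite !(@pop_wide (maxn (size p) (size q)) _ c) ?leq_maxl ?leq_maxr //.
  by rewrite -big_split; apply: eq_bigr => i _; rewrite coefD rmorphD scalerDl.
exact: size_polyD.
Qed.

Lemma popZ (r : R) p c : pop (r *: p) c = r%:C *: pop p c.
Proof.
rewrite (@pop_wide (size p)) ?size_scale_leq // /pop scaler_sumr.
by apply: eq_bigr => i _; rewrite coefZ rmorphM scalerA.
Qed.

Lemma popN p c : pop (- p) c = - pop p c.
Proof. by rewrite -[- p]scaleN1r popZ rmorphN1 scaleN1r. Qed.

Lemma popC (r : R) c : pop r%:P c = r%:C *: c.
Proof.
by rewrite (@pop_wide 1) ?size_polyC_leq1 // big_ord1 coefC.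
Qed.

Lemma popMX p c : pop (p * 'X) c = T (pop p c).
Proof.
have [->|p0] := eqVneq p 0; first by rewrite mul0r popC scale0r linear0.
rewrite /pop size_mulX // big_ord_recl /= coefMX /= scale0r add0r linear_sum.
by apply: eq_bigr => i _; rewrite coefMX /= linearZ.
Qed.

Lemma popX c : pop 'X c = T c.
Proof. by rewrite -(mul1r 'X) popMX popC scale1r. Qed.

Lemma popM p q c : pop (p * q) c = pop p (pop q c).
Proof.
elim/poly_ind: p => [|p r IH]; first by rewrite mul0r !popC !scale0r.
by rewrite mulrDl mulrAC !popD !popMX IH mul_polyC popZ popC.
Qed.

Lemma pop_comm p c : pop p (T c) = T (pop p c).
Proof. by rewrite -[T c]popX -popM mulrC popM popX. Qed.

Lemma pop1 c : pop 1 c = c.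
Proof. by rewrite popC scale1r. Qed.

End PolynomialCalculus.

Section CStarAlgebra.
Context {R : realType} {B : cstarAlgType R}.
Implicit Types a b c d h : B.

Lemma cmulNl a b : (- a) ** b = - (a ** b).
Proof. by rewrite -scaleN1r cmulZl scaleN1r. Qed.
Lemma cmulNr a b : a ** (- b) = - (a ** b).
Proof. by rewrite -scaleN1r cmulZr scaleN1r. Qed.
Lemma cmul0r a : a ** 0 = 0.
Proof. by rewrite -(scale0r (0 : B)) cmulZr !scale0r. Qed.
Lemma starN a : star (- a) = - star a.
Proof. by rewrite -scaleN1r starZ rmorphN1 scaleN1r. Qed.
Lemma starZr (t : R) a : star (t%:C *: a) = t%:C *: star a.
Proof. by rewrite starZ; congr (_ *: _); apply/CrealP; apply/complex_realP; exists t. Qed.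
Lemma starZi a : star ('i%C *: a) = - ('i%C *: star a).
Proof.
rewrite starZ -scaleNr; congr (_ *: _).
by apply/eqP; rewrite eq_complex /= oppr0 !eqxx.
Qed.
Lemma star0 : star (0 : B) = 0.
Proof. by have := starZr 0 (0 : B); rewrite !scale0r. Qed.

Lemma nrM a b : nr (a ** b) <= nr a * nr b.
Proof. by have := normM_le a b; rewrite !normE -rmorphM lecR. Qed.

Lemma nr_starM a : nr (star a ** a) = nr a ^+ 2.
Proof. by apply: complexI; rewrite rmorphXn /= -!normE norm_starM. Qed.

Lemma nr_star a : nr (star a) = nr a.
Proof.
suff le b : nr b <= nr (star b) by apply/le_anti; rewrite le andbT -{2}(starK a).
have := nrM (star b) b; rewrite nr_starM expr2.
have := nr_ge0 b; rewrite le_eqVlt => /predU1P[<- _|b0]; first exact: nr_ge0.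
by rewrite ler_pM2r.
Qed.

Definition symmetric_op (T : B -> B) := forall c d, star (T c) ** d = star c ** T d.

HB.instance Definition _ a := GRing.isLinear.Build R[i] B B *:%R (@cmul R B a)
  (fun k x y => etrans (cmulDr a (k *: x) y)
     (congr1 (fun z => z + a ** y) (cmulZr k a x))).

Definition Lmul a : {linear B -> B} := @cmul R B a.

Lemma pop_symmetric (T : {linear B -> B}) p :
  symmetric_op T -> symmetric_op (pop T p).
Proof.
move=> sT c d; elim/poly_ind: p c d => [|p r IH] c d.
  by rewrite !popC !scale0r star0 cmul0l cmul0r.
rewrite !popD !popC starD starZr cmulDl cmulDr cmulZl cmulZr !popMX sT IH.
by rewrite pop_comm.
Qed.

(* By the C*-identity, [c + i T c] and [c - i T c] have the same norm. *)
Lemma accretive_sqr (T : {linear B -> B}) : symmetric_op T ->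
  accretive (fun c => T (T c)).
Proof.
move=> sT t c t0; set s := Num.sqrt t.
have st : s ^+ 2 = t by rewrite sqr_sqrtr.
have key d : nr (d + s%:C *: ('i%C *: T d)) = nr (d - s%:C *: ('i%C *: T d)).
  apply/eqP; rewrite -(@eqrXn2 _ 2%N) ?nr_ge0 // -!nr_starM; apply/eqP; congr nr.
  rewrite !(starD, starN, starZr, starZi).
  rewrite !(cmulDl, cmulDr, cmulNl, cmulNr, cmulZl, cmulZr) sT.
  by lin.
pose u := c + s%:C *: ('i%C *: T c); pose v := c - s%:C *: ('i%C *: T c).
have i2 : scalar_sqz 'i%C * scalar_sqz 'i%C = -1 :> @sqz _ B.
  by rewrite -rmorphM /= -expr2 sqr_i rmorphN1.
have t2 : scalar_sqz t%:C = scalar_sqz s%:C ^+ 2 :> @sqz _ B.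
  by rewrite -rmorphXn /= -rmorphXn st.
have eu : u - s%:C *: ('i%C *: T u) = c + t%:C *: T (T c).
  rewrite linearD !linearZ; apply: in_sqz_inj.
  by rewrite ?(in_sqzD, in_sqzN, in_sqzZ) t2; ring: i2.
have ev : v + s%:C *: ('i%C *: T v) = c + t%:C *: T (T c).
  rewrite linearB !linearZ; apply: in_sqz_inj.
  by rewrite ?(in_sqzD, in_sqzN, in_sqzZ) t2; ring: i2.
have e4 : 4%:C *: c = (u + s%:C *: ('i%C *: T u)) + (v - s%:C *: ('i%C *: T v)) +
   2%:C *: (c + t%:C *: T (T c)).
  rewrite !(linearB, linearD) !linearZ; apply: in_sqz_inj.
  rewrite ?(in_sqzD, in_sqzN, in_sqzZ) t2 !rmorph_nat; ring: i2.
have := congr1 (@nr R B) e4; rewrite nrZp // => e4'.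
have : 4 * nr c <= nr (c + t%:C *: T (T c)) + nr (c + t%:C *: T (T c)) + 2 * nr (c + t%:C *: T (T c)).
  rewrite e4'; apply: (le_trans (nrD _ _)); rewrite lerD //; last by rewrite nrZp.
  by apply: (le_trans (nrD _ _)); rewrite (key u) -(key v) eu ev.
lra.
Qed.

End CStarAlgebra.

Section NormBound.
Context {R : realType} {B : cstarAlgType R} (T : {linear B -> B}).
Hypothesis symT : symmetric_op T.
Implicit Types p q : {poly R}.

Definition pos_poly p := accretive (pop T p).

Lemma pos_polyD p q : pos_poly p -> pos_poly q -> pos_poly (p + q).
Proof.
move=> ap aq; apply: eq_accretive (accretive_add (pop_is_linear T p) ap aq) => c.
by rewrite popD.
Qed.

Lemma pos_polyZ (r : R) p : 0 <= r -> pos_poly p -> pos_poly (r *: p).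
Proof.
by move=> r0 ap; apply: eq_accretive (accretive_scale r0 ap) => c; rewrite popZ.
Qed.

Lemma pos_poly_sqr p : pos_poly (p ^+ 2).
Proof.
apply: eq_accretive (accretive_sqr (pop_symmetric p symT)) => c.
by rewrite expr2 popM.
Qed.

Lemma pos_poly_lower p c : pos_poly (p - 2%:P) -> 2 * nr c <= nr (pop T p c).
Proof.
move=> ap; have := @accretive_lower_bound _ _ _ 2 1 c _ _ ap.
have -> : 2%:C *: c + 1%:C *: pop T (p - 2%:P) c = pop T p c.
  by rewrite popD popN popC scale1r addrC subrK.
by apply.
Qed.

Lemma pop_exp_bound p n (r : R) c : 0 <= r ->
  (forall d, nr (pop T p d) <= r * nr d) -> nr (pop T (p ^+ n) c) <= r ^+ n * nr c.
Proof.
move=> r0 H; elim: n => [|n IH]; first by rewrite !expr0 pop1 mul1r.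
by rewrite !exprS popM (le_trans (H _)) // -mulrA ler_wpM2l.
Qed.

(* [2 + D k] below is [(1 + x)^(2^k) + (1 - x)^(2^k)], and [D k] is a sum of
   squares by the recursion [D (k + 1) = (D k ^ 2 + 4 D k + P k ^ 2) / 2] with
   [P k = (1 + x)^(2^k) - (1 - x)^(2^k)]. *)
Lemma double_lower (x : {poly R}) k c :
  2 ^+ k.+1 * nr (pop T x c) <=
    nr (pop T ((1 + x) ^+ (2 ^ k) - (1 - x) ^+ (2 ^ k)) c).
Proof.
pose P j := (1 + x) ^+ (2 ^ j) - (1 - x) ^+ (2 ^ j).
pose D j := (1 + x) ^+ (2 ^ j) + (1 - x) ^+ (2 ^ j) - 2%:P.
have c2 : 2%:P = 2 :> {poly R} by rewrite rmorph_nat.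
have Dpos j : pos_poly (D j).
  elim: j => [|j IH].
    have -> : D 0%N = 0 ^+ 2 by rewrite /D !expn0 !expr1 c2; ring.
    exact: pos_poly_sqr.
  have -> : D j.+1 = 2^-1 *: (D j ^+ 2 + 4 *: D j + P j ^+ 2).
    apply: (@scalerI _ _ (2 : R)); first by rewrite pnatr_eq0.
    rewrite scalerA mulfV ?pnatr_eq0 // scale1r /D /P !expnSr !exprM c2.
    by rewrite !scaler_nat; ring.
  apply: pos_polyZ => //; apply: pos_polyD; last exact: pos_poly_sqr.
  apply: pos_polyD; first exact: pos_poly_sqr.
  exact: pos_polyZ.
suff : 2 ^+ k.+1 * nr (pop T x c) <= nr (pop T (P k) c) by [].
elim: k => [|k IH].
  have -> : P 0%N = 2 *: x by rewrite /P !expn0 !expr1 scaler_nat; ring.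
  by rewrite popZ nrZp.
have -> : P k.+1 = (D k + 2%:P) * P k by rewrite /P /D !expnSr !exprM; ring.
rewrite popM exprS -mulrA (@le_trans _ _ (2 * nr (pop T (P k) c))) //.
  by rewrite ler_wpM2l.
by apply: pos_poly_lower; rewrite addrK.
Qed.

(* If both [T] and [r - T] are positive then [sinh (T / r)] is bounded, and
   [sinh y / y >= 1]; the exponentials are replaced by powers of [1 + x] and
   [1 - x] with [x = T / (n r)]. *)
Lemma accretive_norm_bound (M r : R) c : 0 < r ->
  (forall d, nr (T d) <= M * nr d) ->
  accretive T -> accretive (fun d => r%:C *: d - T d) ->
  nr (T c) <= r * expR 2 * nr c.
Proof.
move=> r0 TM aT arT.
wlog M0 : M TM / 0 <= M => [H|].
  apply: (H `|M|) => // d; apply: (le_trans (TM d)).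
  by rewrite ler_wpM2r ?nr_ge0 // ler_norm.
pose N := (1 + M / r) ^+ 2.
have [k kN] : exists k, N <= (2 ^ k)%:R :> R.
  exists (Num.truncn N).+1.
  rewrite (le_trans (ltW (truncnS_gt N))) // ler_nat.
  exact/ltnW/ltn_expl.
set n := (2 ^ k)%N in kN.
have n0 : 0 < n%:R :> R by rewrite ltr0n expn_gt0.
pose x : {poly R} := (n%:R * r)^-1 *: 'X.
have nr0 : 0 < n%:R * r by rewrite mulr_gt0.
have Mr0 : 0 <= M / r by rewrite divr_ge0 // ltW.
have xE d : pop T x d = (n%:R * r)^-1%:C *: T d by rewrite popZ popX.
have small (y : {poly R}) (s : R) : 0 <= s -> s <= (1 + M / r) / n%:R ->
    pos_poly y -> (forall d, nr (pop T y d) <= s * nr d) ->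
    forall d, nr (pop T (1 - y) d) <= (1 + n%:R^-1) * nr d.
  move=> s0 sn py ys d; have := py 1 (pop T (1 - y) d) ler01.
  rewrite scale1r -[X in nr (X + _)](pop1 T) -popD -!popM.
  have -> : (1 + y) * (1 - y) = 1 - y * y by ring.
  move=> /le_trans; apply; rewrite popD popN pop1 popM mulrDl mul1r.
  apply: (le_trans (nrB _ _)); rewrite lerD2l.
  apply: (le_trans (ys _)).
  apply: (@le_trans _ _ (s * (s * nr d))); first by rewrite ler_wpM2l.
  rewrite mulrA ler_wpM2r ?nr_ge0 //.
  apply: (@le_trans _ _ (((1 + M / r) / n%:R) ^+ 2)).
    by rewrite expr2 ler_pM.
  rewrite expr_div_n -/N ler_pdivrMr ?exprn_gt0 // expr2 mulrA mulVf ?mul1r //.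
  by rewrite gt_eqF.
have xM d : nr (pop T x d) <= (M / r / n%:R) * nr d.
  rewrite xE nrZp ?invr_ge0 ?(ltW nr0) //.
  have -> : M / r / n%:R * nr d = (n%:R * r)^-1 * (M * nr d).
    by field; rewrite !gt_eqF.
  by rewrite ler_wpM2l // invr_ge0 ltW.
have lem d : nr (pop T (1 - x) d) <= (1 + n%:R^-1) * nr d.
  apply: (small x (M / r / n%:R)) => //.
  - by rewrite divr_ge0 // ltW.
  - by rewrite ler_wpM2r ?invr_ge0 ?(ltW n0) // lerDr.
  - apply: eq_accretive (accretive_scale _ aT) => [e|]; first by rewrite xE.
    by rewrite invr_ge0 ltW.
pose y := n%:R^-1%:P - x.
have ley d : nr (pop T (1 - y) d) <= (1 + n%:R^-1) * nr d.
  apply: (small y ((1 + M / r) / n%:R)) => //.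
  - by rewrite divr_ge0 ?addr_ge0 // ltW.
  - apply: (@eq_accretive _ _ (fun e => (n%:R * r)^-1%:C *: (r%:C *: e - T e))) => [e|].
      have nr : (n%:R * r)^-1 * r = n%:R^-1 by field; rewrite !gt_eqF.
      by rewrite popD popN popC xE scalerBr scalerA -rmorphM /= nr.
    by apply: accretive_scale => //; rewrite invr_ge0 ltW.
  - move=> e; rewrite popD popN popC (le_trans (nrB _ _)) // nrZp ?invr_ge0 ?(ltW n0) //.
    by rewrite mulrDl mul1r mulrDl lerD2l.
have gex d : nr (pop T (1 + x) d) <= (1 + 2 / n%:R) * nr d.
  have -> : 1 + x = (1 - y) + n%:R^-1%:P by rewrite /y; ring.
  rewrite popD popC (le_trans (nrD _ _)) // nrZp ?invr_ge0 ?(ltW n0) //.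
  have := ley d; lra.
have big (s : R) : 0 <= s -> s <= 2 -> (1 + s / n%:R) ^+ n <= expR 2.
  move=> s0 s2; have -> : expR 2 = expR (2 / n%:R) ^+ n :> R.
    by rewrite -expRM_natl mulrC divfK // gt_eqF.
  rewrite lerXn2r ?nnegrE ?expR_ge0 //; first by rewrite addr_ge0 // divr_ge0 // ltW.
  apply: (le_trans _ (expR_ge1Dx _)).
  by rewrite lerD2l ler_wpM2r // invr_ge0 ltW.
have H1 : nr (pop T ((1 + x) ^+ n) c) <= expR 2 * nr c.
  apply: (le_trans (pop_exp_bound n c _ gex)); first by rewrite addr_ge0 // divr_ge0 // ltW.
  by rewrite ler_wpM2r ?nr_ge0 // big.
have H2 : nr (pop T ((1 - x) ^+ n) c) <= expR 2 * nr c.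
  apply: (le_trans (pop_exp_bound n c _ lem)); first by rewrite addr_ge0 // invr_ge0 ltW.
  rewrite ler_wpM2r ?nr_ge0 // -[n%:R^-1]mul1r; apply: big => //.
  by rewrite ler1n.
have := double_lower x k c; rewrite -/n popD popN => /le_trans/(_ (nrB _ _)).
rewrite xE nrZp ?invr_ge0 ?(ltW nr0) //.
have -> : 2 ^+ k.+1 * ((n%:R * r)^-1 * nr (T c)) = 2 * (nr (T c) / r).
  rewrite exprS -natrX -/n; field.
  by rewrite !gt_eqF.
move=> H3.
have : nr (T c) / r <= expR 2 * nr c by lra.
by rewrite ler_pdivrMr // mulrC mulrA.
Qed.

End NormBound.

Section Positivity.
Context {R : realType} {B : cstarAlgType R}.
Implicit Types (a b c d h : B) (p f : {poly R}).

Lemma LmulE a c : Lmul a c = a ** c. Proof. by []. Qed.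

Lemma Lmul_symmetric h : star h = h -> symmetric_op (Lmul h).
Proof. by move=> sh c d; rewrite !LmulE starM sh cmulA. Qed.

Lemma pop_Lmul h p c d : pop (Lmul h) p (c ** d) = pop (Lmul h) p c ** d.
Proof.
elim/poly_ind: p => [|p r IH]; first by rewrite !popC !scale0r cmul0l.
by rewrite !popD !popMX !popC IH cmulDl cmulZl !LmulE cmulA.
Qed.

Lemma pop_intertwine a b p c :
  a ** pop (Lmul (b ** a)) p c = pop (Lmul (a ** b)) p (a ** c).
Proof.
elim/poly_ind: p => [|p r IH]; first by rewrite !popC !scale0r cmul0r.
by rewrite !popD !popMX !popC cmulDr cmulZr -IH !LmulE !cmulA.
Qed.

(* [2 (b b^* + b^* b)] is the sum of the squares of the self-adjoint elements
   [b + b^*] and [i (b - b^* )]. *)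
Lemma accretive_starM_add b :
  accretive (fun c => b ** (star b ** c) + star b ** (b ** c)).
Proof.
pose u := b + star b; pose v := 'i%C *: (b - star b).
have su : star u = u by rewrite starD starK addrC.
have sv : star v = v.
  by rewrite starZi starD starN starK -scalerN opprB.
have lu : linear (fun c => Lmul u (Lmul u c)) by move=> k x y; rewrite !linearP.
have au := accretive_sqr (Lmul_symmetric su).
have av := accretive_sqr (Lmul_symmetric sv).
apply: eq_accretive (accretive_scale (r := 2^-1) _ (accretive_add lu au av)) => // c.
have i2 : scalar_sqz 'i%C * scalar_sqz 'i%C = -1 :> @sqz _ B.
  by rewrite -rmorphM /= -expr2 sqr_i rmorphN1.
have -> : 2^-1%:C = 2^-1 :> R[i] by rewrite fmorphV rmorph_nat.
apply: (@scalerI _ _ (2 : R[i])); first by rewrite pnatr_eq0.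
rewrite scalerA mulfV ?pnatr_eq0 // scale1r !LmulE /u /v.
rewrite !(cmulDl, cmulDr, cmulNl, cmulNr, cmulZl, cmulZr).
apply: in_sqz_inj; rewrite ?(in_sqzD, in_sqzN, in_sqzZ); ring: i2.
Qed.

Section Contraction.
Variable a : B.
Hypothesis a1 : nr a <= 1.
Let h := star a ** a.
Let k := a ** star a.

Let sh : star h = h. Proof. by rewrite starM starK. Qed.
Let sk : star k = k. Proof. by rewrite starM starK. Qed.

Definition joint_pos p := accretive (fun c => pop (Lmul h) p c + pop (Lmul k) p c).

Let joint_linear p : linear (fun c => pop (Lmul h) p c + pop (Lmul k) p c).
Proof. by move=> t x y; rewrite !linearP; lin. Qed.

Lemma joint_posD p q : joint_pos p -> joint_pos q -> joint_pos (p + q).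
Proof.
move=> pp pq; apply: eq_accretive (accretive_add (joint_linear p) pp pq) => c.
by rewrite !popD addrACA.
Qed.

Lemma joint_posZ (r : R) p : 0 <= r -> joint_pos p -> joint_pos (r *: p).
Proof.
move=> r0 pp; apply: eq_accretive (accretive_scale r0 pp) => c.
by rewrite !popZ scalerDr.
Qed.

Lemma joint_posX_sqr f : joint_pos ('X * f ^+ 2).
Proof.
set P := pop (Lmul h) f.
have sP c d : star (P c) ** d = star c ** P d by apply/pop_symmetric/Lmul_symmetric.
apply: eq_accretive (accretive_starM_add (P (star a))) => c.
have sPa d : star (P (star a)) ** d = a ** P d by rewrite sP starK.
rewrite !sPa -!pop_Lmul; congr (_ + _).
  have -> : 'X * f ^+ 2 = f * 'X * f by ring.
  by rewrite !popM popX !LmulE /h -cmulA.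
have -> : 'X * f ^+ 2 = f ^+ 2 * 'X by ring.
by rewrite popM popX LmulE /k -cmulA -pop_intertwine expr2 popM.
Qed.

Let bound (b : B) n d : nr b <= 1 ->
  nr (pop (Lmul b) ('X * (1 - 'X ^+ n)) d) <= 2 * nr d.
Proof.
move=> b1; have bX e : nr (pop (Lmul b) 'X e) <= 1 * nr e.
  by rewrite popX (le_trans (nrM _ _)) // ler_wpM2r ?nr_ge0.
rewrite mulrBr mulr1 -exprS popD popN (le_trans (nrB _ _)) //.
have := pop_exp_bound n.+1 d ler01 bX; rewrite expr1n.
have := bX d; lra.
Qed.

Let h1 : nr h <= 1.
Proof. by rewrite nr_starM expr_le1 // nr_ge0. Qed.

Let k1 : nr k <= 1.
Proof.
have := nr_starM (star a); rewrite starK -/k nr_star => ->.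
by rewrite expr_le1 // nr_ge0.
Qed.

(* Iterating [1 - y = (1 - y)^2 / 2 + (1 - y^2) / 2]. *)
Lemma joint_posX1X_sqr f : joint_pos ('X * (1 - 'X) * f ^+ 2).
Proof.
pose rest J := 'X * (1 - 'X ^+ (2 ^ J)) * f ^+ 2 : {poly R}.
have split J : exists2 S, joint_pos S &
    'X * (1 - 'X) * f ^+ 2 = S + (2 ^- J : R) *: rest J.
  elim: J => [|J [S pS ->]].
    exists ('X * 0 ^+ 2); first exact: joint_posX_sqr.
    by rewrite /rest expr0 invr1 scale1r expn0 expr1; ring.
  exists (S + (2 ^- J.+1 : R) *: ('X * ((1 - 'X ^+ (2 ^ J)) * f) ^+ 2)).
    apply: joint_posD => //; apply: joint_posZ; last exact: joint_posX_sqr.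
    by rewrite invr_ge0 exprn_ge0.
  rewrite -addrA; congr (_ + _); rewrite -scalerDr.
  have -> : (2 ^- J : R) = 2 ^- J.+1 * 2 by rewrite exprS invfM mulrAC mulVf ?mul1r // pnatr_eq0.
  rewrite -scalerA; congr (_ *: _); rewrite /rest expnSr exprM scaler_nat.
  by ring.
apply: accretive_limit => c.
set C := 2 * nr (pop (Lmul h) (f ^+ 2) c) + 2 * nr (pop (Lmul k) (f ^+ 2) c).
have C0 : 0 <= C by rewrite addr_ge0 ?mulr_ge0 ?nr_ge0.
exists C => // e e0.
have [J Je] : exists J, (2 ^- J : R) <= e.
  exists (Num.truncn e^-1).+1.
  rewrite invf_ple ?posrE ?exprn_gt0 // (le_trans (ltW (truncnS_gt _))) //.
  by rewrite -natrX ler_nat ltnW // ltn_expl.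
have [S pS eS] := split J.
exists (fun d => pop (Lmul h) S d + pop (Lmul k) S d) => //.
rewrite eS !popD !popZ.
set u := pop _ S c; set v := pop _ S c.
have -> : u + v - (u + (2 ^- J)%:C *: pop (Lmul h) (rest J) c +
   (v + (2 ^- J)%:C *: pop (Lmul k) (rest J) c)) =
   - ((2 ^- J)%:C *: (pop (Lmul h) (rest J) c + pop (Lmul k) (rest J) c)) by lin.
rewrite nrN nrZp ?invr_ge0 ?exprn_ge0 // [C * e]mulrC.
apply: ler_pM; rewrite ?nr_ge0 ?invr_ge0 ?exprn_ge0 //.
apply: (le_trans (nrD _ _)).
by rewrite /rest ![pop _ (_ * f ^+ 2) c]popM lerD // bound.
Qed.

Lemma joint_pos_power m : joint_pos (1 - (1 - 'X) ^+ (2 * m)).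
Proof.
elim: m => [|m IH].
  have -> : 1 - (1 - 'X) ^+ (2 * 0) = 'X * 0 ^+ 2 :> {poly R} by rewrite muln0; ring.
  exact: joint_posX_sqr.
have -> : 1 - (1 - 'X) ^+ (2 * m.+1) = (1 - (1 - 'X) ^+ (2 * m)) +
   ('X * ((1 - 'X) ^+ m) ^+ 2 + 'X * (1 - 'X) * ((1 - 'X) ^+ m) ^+ 2) :> {poly R}.
  by rewrite mulnS exprD ![(2 * m)%N]mulnC exprM; ring.
apply: joint_posD => //; apply: joint_posD; first exact: joint_posX_sqr.
exact: joint_posX1X_sqr.
Qed.

Lemma power_bounded m c :
  nr (pop (Lmul h) ((1 - 'X) ^+ (2 * m)) c) <= 2 * expR 2 * nr c.
Proof.
set F : {poly R} := (1 - 'X) ^+ (2 * m).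
have sF : symmetric_op (pop (Lmul h) F) by apply/pop_symmetric/Lmul_symmetric.
have aF b : star b = b -> accretive (pop (Lmul b) F).
  move=> sb; rewrite /F mulnC exprM; exact/pos_poly_sqr/Lmul_symmetric.
apply: (accretive_norm_bound sF (M := 2 ^+ (2 * m))) => //.
- move=> d; apply: pop_exp_bound => // e.
  rewrite popD popN pop1 popX (le_trans (nrB _ _)) //.
  have := le_trans (nrM h e) (ler_wpM2r (nr_ge0 e) h1); lra.
- exact: aF.
apply: eq_accretive (accretive_add (joint_linear _) (joint_pos_power m) (aF k sk)) => d.
rewrite !popD !popN !pop1 -/F rmorph_nat; lin.
Qed.

Lemma contract_starM c : nr (c - h ** c) <= nr c.
Proof.
set F : {poly R} := 1 - 'X.
have -> : c - h ** c = pop (Lmul h) F c by rewrite popD popN pop1 popX.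
set x := nr (pop _ _ c); set y := nr c.
have sq q : nr (pop (Lmul h) q c) ^+ 2 <= y * nr (pop (Lmul h) (q ^+ 2) c).
  rewrite -nr_starM pop_symmetric; last exact: Lmul_symmetric.
  by rewrite (le_trans (nrM _ _)) // nr_star -popM.
have [y0|y0] := eqVneq y 0.
  by rewrite /x (nr0_eq0 y0) linear0 nr0 /y nr_ge0.
have {}y0 : 0 < y by rewrite lt_def y0 nr_ge0.
have key j : x ^+ (2 ^ j) * y <= y ^+ (2 ^ j) * nr (pop (Lmul h) (F ^+ (2 ^ j)) c).
  elim: j => [|j IH]; first by rewrite expn0 !expr1 mulrC.
  rewrite -(ler_pM2r y0) expnSr !exprM.
  have -> : (x ^+ (2 ^ j)) ^+ 2 * y * y = (x ^+ (2 ^ j) * y) ^+ 2 by ring.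
  have x0 : 0 <= x ^+ (2 ^ j) * y by rewrite mulr_ge0 ?exprn_ge0 ?nr_ge0 // ltW.
  apply: (@le_trans _ _ ((y ^+ (2 ^ j) * nr (pop (Lmul h) (F ^+ (2 ^ j)) c)) ^+ 2)).
    by rewrite lerXn2r ?nnegrE // (le_trans x0).
  rewrite exprMn -[leRHS]mulrA; apply: ler_wpM2l; first by rewrite sqr_ge0.
  by rewrite mulrC sq.
rewrite leNgt; apply/negP => yx.
pose d := x / y - 1.
have d0 : 0 < d by rewrite subr_gt0 ltr_pdivlMr // mul1r.
pose C : R := 2 * expR 2.
have CP j : 1 + (2 ^ j)%:R * d <= C.
  have H : 1 + (2 ^ j.+1)%:R * d <= C.
    have := power_bounded (2 ^ j) c; rewrite -expnS -/F -/C => PB.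
    have := le_trans (key j.+1) (ler_wpM2l (exprn_ge0 _ (ltW y0)) PB).
    rewrite -/y mulrA ler_pM2r // => H.
    have : (x / y) ^+ (2 ^ j.+1) <= C.
      by rewrite expr_div_n ler_pdivrMr ?exprn_gt0 // mulrC.
    apply: le_trans.
    have -> : x / y = 1 + d by rewrite /d; ring.
    elim: (2 ^ j.+1)%N => [|n IH]; first by rewrite mul0r addr0 expr0.
    rewrite exprS (le_trans _ (ler_wpM2l _ IH)) //; last by lra.
    rewrite -addn1 natrD; have : 0 <= n%:R * d ^+ 2 by rewrite mulr_ge0 ?sqr_ge0.
    by nra.
  apply: le_trans H; rewrite lerD2l ler_wpM2r ?(ltW d0) // ler_nat.
  by rewrite leq_exp2l.
have := CP (Num.truncn (C / d)).+1; set j := Num.truncn _.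
apply/negP; rewrite -ltNge (@lt_trans _ _ (j.+1%:R * d)) //.
  by rewrite -ltr_pdivrMr // truncnS_gt.
rewrite (@le_lt_trans _ _ ((2 ^ j.+1)%:R * d)) ?ltrDr //.
by rewrite ler_wpM2r ?(ltW d0) // ler_nat ltnW // ltn_expl.
Qed.

End Contraction.

Lemma accretive_starM a : accretive (Lmul (star a ** a)).
Proof.
have [a0|a0] := eqVneq (nr a) 0.
  rewrite (nr0_eq0 a0) => t c t0.
  by rewrite !LmulE cmul0r cmul0l scaler0 addr0.
have {}a0 : 0 < nr a by rewrite lt_def a0 nr_ge0.
set b := (nr a)^-1%:C *: a.
have b1 : nr b <= 1 by rewrite nrZp ?invr_ge0 ?nr_ge0 // mulVf // gt_eqF.
have ab : a = (nr a)%:C *: b.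
  by rewrite /b scalerA -rmorphM /= mulfV ?scale1r // gt_eqF.
apply: (@eq_accretive _ _ (fun c => (nr a ^+ 2)%:C *: (star b ** b ** c))).
  have E : star a ** a = (nr a ^+ 2)%:C *: (star b ** b).
    by rewrite [in LHS]ab starZr cmulZl cmulZr scalerA expr2 rmorphM.
  by move=> c; rewrite LmulE E cmulZl.
apply: accretive_scale; first exact: sqr_ge0.
apply: (@eq_accretive _ _ (fun c => 1%:C *: c - (c - star b ** b ** c))).
  by move=> c; rewrite scale1r opprB addrCA subrr addr0.
by apply: accretive_bound => c; rewrite mul1r contract_starM.
Qed.

(* The best constant is 1. *)
Lemma starM_le a c :
  nr a ^+ 2 <= expR 2 * nr (star a ** a + star c ** c).
Proof.
rewrite -nr_starM; set h := star a ** a; set k := star c ** c; set s := nr (h + k).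
have sh : star h = h by rewrite starM starK.
apply: (@le_addeM _ _ _ (expR 2) 1) => // e e0 _.
rewrite -mulrDr mulrC.
have se : 0 < s + e by rewrite ltr_wpDl // nr_ge0.
have H d : nr (Lmul h d) <= (s + e) * expR 2 * nr d.
  apply: (accretive_norm_bound (Lmul_symmetric sh) (M := nr h)) => //.
  - by move=> x; rewrite nrM.
  - exact: accretive_starM.
  have acs : accretive (fun x => (s + e)%:C *: x - Lmul (h + k) x).
    apply: accretive_bound => x; apply: (le_trans (nrM _ _)).
    by rewrite ler_wpM2r ?nr_ge0 // lerDl ltW.
  apply: eq_accretive (accretive_add _ acs (accretive_starM c)) => [x|r x y].
    by rewrite !LmulE cmulDl -/k; lin.
  by rewrite [Lmul _ (_ + _)]linearP; lin.
have := H h; rewrite !LmulE -{1}sh nr_starM expr2.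
have := nr_ge0 h; rewrite le_eqVlt => /predU1P[<- _|h0].
  by rewrite mulr_ge0 ?expR_ge0 // ltW.
by rewrite ler_pM2r // mulrC.
Qed.

End Positivity.

Section InnerProductModuleTheory.
Context {R : realType} {B : cstarAlgType R} {F : innerProductModType B}.
Implicit Types (x y z : F) (a b : B).

Lemma ipDl x y z : ip (x + y) z = ip x z + ip y z :> B.
Proof. by rewrite -[LHS]ip_star ipDr starD !ip_star. Qed.

Lemma ipZl (k : R[i]) x z : ip (k *: x) z = Num.conj k *: ip x z :> B.
Proof. by rewrite -[LHS]ip_star ipZr starZ ip_star. Qed.

Lemma ip_actl x y a : ip (act x a) y = star a ** ip x y.
Proof. by rewrite -[LHS]ip_star ip_act starM ip_star. Qed.

Lemma ipNr x y : ip x (- y) = - ip x y :> B.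
Proof. by rewrite -scaleN1r ipZr scaleN1r. Qed.

Lemma ipNl x y : ip (- x) y = - ip x y :> B.
Proof. by rewrite -[LHS]ip_star ipNr starN ip_star. Qed.

Lemma ip0r x : ip x 0 = 0 :> B.
Proof. by rewrite -(scale0r (0 : F)) ipZr !scale0r. Qed.

Lemma ip0l x : ip 0 x = 0 :> B.
Proof. by rewrite -[LHS]ip_star ip0r star0. Qed.

Lemma actNl x a : act (- x) a = - act x a.
Proof. by rewrite -scaleN1r actZl scaleN1r. Qed.

Lemma actNr x a : act x (- a) = - act x a.
Proof. by rewrite -scaleN1r actZr scaleN1r. Qed.

Lemma act0l a : act 0 a = 0 :> F.
Proof. by rewrite -(scale0r (0 : F)) actZl !scale0r. Qed.

Lemma act0r x : act x (0 : B) = 0.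
Proof. by rewrite -(scale0r (0 : B)) actZr scale0r. Qed.

Lemma ip_suml n x (y : 'I_n -> F) : ip (\sum_i y i) x = \sum_i ip (y i) x :> B.
Proof.
elim: n y => [|n IH] y; first by rewrite !big_ord0 ip0l.
by rewrite !big_ord_recl ipDl IH.
Qed.

Lemma rank1_ip x x' y y' : rank1 x y \o rank1 x' y' = rank1 (act x (ip y x' : B)) y'.
Proof. by apply/funext => z; rewrite /rank1 /= ip_act actA. Qed.

End InnerProductModuleTheory.

Section ClosedSpan.
Context {R : realType} {V : normedModType R[i]}.
Implicit Types (K A : set V).

Lemma closed_approx K v : closed K ->
  (forall e : R, 0 < e -> exists2 w, K w & nr (v - w) < e) -> K v.
Proof.
move=> cK H; apply: cK; apply/closureP => e /gt0C[d d0 ->].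
by have [w Kw vw] := H d d0; exists w => //; rewrite normE ltcR.
Qed.

Lemma closure_approx A v (e : R) : closure A v -> 0 < e ->
  exists2 w, A w & nr (v - w) < e.
Proof.
move=> /closureP Av e0; have [w Aw vw] := Av e%:C ltac:(by rewrite ltr0C).
by exists w => //; rewrite normE ltcR in vw.
Qed.

End ClosedSpan.

Section Subspace.
Context {R : realType} {V : lmodType R[i]} (K : set V).
Hypothesis subK : is_subspace K.

Lemma subspace0 : K 0. Proof. exact: subK.1. Qed.

Lemma subspaceZ (k : R[i]) x : K x -> K (k *: x).
Proof. by move=> Kx; rewrite -[_ *: x]addr0; apply: subK.2 => //; exact: subspace0. Qed.

Lemma subspaceD x y : K x -> K y -> K (x + y).
Proof. by move=> Kx Ky; rewrite -[x]scale1r; exact: subK.2. Qed.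

Lemma subspaceN x : K x -> K (- x).
Proof. by move=> Kx; rewrite -scaleN1r; exact: subspaceZ. Qed.

Lemma subspaceB x y : K x -> K y -> K (x - y).
Proof. by move=> Kx Ky; apply: subspaceD => //; exact: subspaceN. Qed.

Lemma subspace_sum n (f : 'I_n -> V) : (forall i, K (f i)) -> K (\sum_i f i).
Proof.
move=> Kf; elim/big_ind: _ => //; [exact: subspace0|exact: subspaceD].
Qed.

Lemma linspan_sub (A : set V) : A `<=` K -> linspan A `<=` K.
Proof.
move=> AK _ [n [k [x [Ax ->]]]]; apply: subspace_sum => i.
exact/subspaceZ/AK.
Qed.

End Subspace.

Lemma cspan_sub (R : realType) (V : normedModType R[i]) (A K : set V) :
  is_subspace K -> closed K -> A `<=` K -> cspan A `<=` K.
Proof.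
move=> sK cK AK v Av; apply: closed_approx => // e e0.
have [w Aw vw] := closure_approx Av e0.
by exists w => //; apply: (linspan_sub sK AK).
Qed.

Lemma cspan_subspace (R : realType) (V : normedModType R[i]) (A : set V) :
  is_subspace (cspan A).
Proof. exact/closure_subspace/linspan_subspace. Qed.

Lemma cspan_closed (R : realType) (V : normedModType R[i]) (A : set V) :
  closed (cspan A).
Proof. exact: closed_closure. Qed.

Lemma sub_cspan (R : realType) (V : normedModType R[i]) (A : set V) : A `<=` cspan A.
Proof. by move=> x Ax; apply/subset_closure/sub_linspan. Qed.

Section HilbertModuleTheory.
Context {R : realType} {B : cstarAlgType R} {E : hilbertModType B}.
Implicit Types (x y z : E) (a b : B).

Lemma nr_ip x : nr (ip x x : B) = nr x ^+ 2.
Proof.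
by apply: complexI; rewrite rmorphXn /= -!normE hilbert_norm sqrtCK.
Qed.

Lemma nr_act x a : nr (act x a) <= nr x * nr a.
Proof.
rewrite -(@ler_pXn2r _ 2) ?nnegrE ?mulr_ge0 ?nr_ge0 // -nr_ip ip_act ip_actl.
have -> : (nr x * nr a) ^+ 2 = nr a * nr x ^+ 2 * nr a by ring.
rewrite (le_trans (nrM _ _)) // ler_wpM2r ?nr_ge0 //.
by rewrite -nr_ip -(nr_star a) nrM.
Qed.

Lemma conj_real (t : R) : Num.conj t%:C = t%:C :> R[i].
Proof. by apply/CrealP; apply/complex_realP; exists t. Qed.

Lemma nrZi (V : normedModType R[i]) (v : V) : nr ('i%C *: v) = nr v.
Proof. by rewrite nrZ normc_def /= expr0n /= expr1n add0r sqrtr1 mul1r. Qed.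

(* By polarization. The best constant is 1. *)
Lemma nr_ip_le x y : nr (ip x y : B) <= 4 * (nr x * nr y).
Proof.
have pol (u v : E) : 4 * nr (ip u v : B) <= 4 * (nr u + nr v) ^+ 2.
  have le (w : E) : nr (ip (u + w) (u + w) : B) <= (nr u + nr w) ^+ 2.
    by rewrite nr_ip lerXn2r ?nnegrE ?addr_ge0 ?nr_ge0 // nrD.
  have i2 : scalar_sqz 'i%C * scalar_sqz 'i%C = -1 :> @sqz _ B.
    by rewrite -rmorphM /= -expr2 sqr_i rmorphN1.
  have ci : Num.conj 'i%C = - 'i%C :> R[i].
    by apply/eqP; rewrite eq_complex /= oppr0 !eqxx.
  have E4 : 4%:C *: ip u v = ((ip (u + v) (u + v) : B) - ip (u - v) (u - v)) -
     ('i%C *: (ip (u + 'i%C *: v) (u + 'i%C *: v) : B) -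
      'i%C *: ip (u - 'i%C *: v) (u - 'i%C *: v)).
    rewrite !(ipDr, ipDl, ipNr, ipNl, ipZr, ipZl) ci.
    apply: in_sqz_inj; rewrite ?(in_sqzD, in_sqzN, in_sqzZ) rmorph_nat; ring: i2.
  have -> : 4 * nr (ip u v : B) = nr (4%:C *: ip u v : B) by rewrite nrZp.
  rewrite E4 (le_trans (nrB _ _)) //.
  have := nrB (ip (u + v) (u + v) : B) (ip (u - v) (u - v)).
  have := nrB ('i%C *: (ip (u + 'i%C *: v) (u + 'i%C *: v) : B))
      ('i%C *: ip (u - 'i%C *: v) (u - 'i%C *: v)).
  have := le v; have := le (- v).
  have := le ('i%C *: v); have := le (- ('i%C *: v)).
  rewrite !nrZi !nrN nrZi; lra.
have nonzero (u v : E) : nr u = 0 -> nr (ip u v : B) <= 4 * (nr u * nr v).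
  by move/nr0_eq0 ->; rewrite ip0l !nr0 mul0r mulr0.
have [/nonzero//|x0] := eqVneq (nr x) 0.
have [y0|y0] := eqVneq (nr y) 0.
  by rewrite (nr0_eq0 y0) ip0r !nr0 !mulr0.
have {}x0 : 0 < nr x by rewrite lt_def x0 nr_ge0.
have {}y0 : 0 < nr y by rewrite lt_def y0 nr_ge0.
have := pol ((nr x)^-1%:C *: x) ((nr y)^-1%:C *: y).
rewrite ipZr ipZl conj_real !nrZp ?invr_ge0 ?nr_ge0 // !mulVf ?gt_eqF //.
set u := (nr y)^-1 * _; have -> : nr (ip x y : B) = u * (nr x * nr y).
  by rewrite /u; field; rewrite !gt_eqF.
by move=> u16; rewrite ler_wpM2r ?mulr_ge0 ?nr_ge0 //; lra.
Qed.

End HilbertModuleTheory.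

Section ApproximateUnit.
Context {R : realType} {B : cstarAlgType R} {E : hilbertModType B}.
Implicit Types (x y z : E) (a b : B).

Lemma approx_unit_le1 x (e : R) (P : set E) : nr x <= 1 -> 0 < e ->
  is_subspace P -> P x -> (forall y, P (act x (ip x y : B))) ->
  exists2 x', P x' & nr (x - act x (ip x x' : B)) < e.
Proof.
move=> x1 e0 sP Px Pth.
have [c hc] := ip_pos x; set h : B := ip x x in hc.
have c1 : nr c <= 1.
  by rewrite -(@ler_pXn2r _ 2) ?nnegrE ?nr_ge0 // -nr_starM -hc nr_ip lerXn2r ?nnegrE ?nr_ge0.
pose Fb b := b - h ** b.
have FbC b : nr (Fb b) <= nr b by rewrite /Fb hc contract_starM.
have FbB b b' : Fb (b - b') = Fb b - Fb b' by rewrite /Fb cmulDr cmulNr; lin.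
have FbM b b' : Fb (b ** b') = Fb b ** b' by rewrite /Fb cmulDl cmulNl cmulA.
pose th y := act x (ip x y : B); pose st y := y - th y.
have thD y z : th (y + z) = th y + th z by rewrite /th ipDr actDr.
have ip_st n y : ip x (iter n st y) = iter n Fb (ip x y) :> B.
  by elim: n => //= n <-; rewrite {1}/st ipDr ipNr ip_act.
have st_sym n y z : ip (iter n st y) z = ip y (iter n st z) :> B.
  elim: n z => //= n IH z; rewrite -[st (iter n st z)]/(iter n.+1 st z) iterSr -IH.
  by rewrite /st ipDl ipNl ipDr ipNr ip_act ip_actl ip_star.
have iterF n b : nr (iter n Fb b) <= nr b.
  by elim: n => //= n IH; apply: le_trans (FbC _) IH.
have iterFM n b b' : iter n Fb (b ** b') = iter n Fb b ** b'.
  by elim: n => //= n ->; rewrite FbM.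
have iterFB n b b' : iter n Fb (b - b') = iter n Fb b - iter n Fb b'.
  by elim: n => //= n ->; rewrite FbB.
pose S m := \sum_(j < m) iter j st x.
have Stel m b : ip x (S m) ** b = b - iter m Fb b.
  elim: m => [|m IH]; first by rewrite /S big_ord0 ip0r cmul0l subrr.
  rewrite /S big_ord_recr /= -/(S m) ipDr cmulDl IH ip_st -iterFM.
  have -> : h ** b = b - Fb b by rewrite /Fb; lin.
  rewrite iterFB -iterSr /=; lin.
have Sle m : nr (ip x (S m) : B) <= 2.
  set s : B := ip x (S m); have := nr_ge0 s; rewrite le_eqVlt => /predU1P[<-//|s0].
  have : nr (s ** star s) <= 2 * nr s.
    rewrite Stel (le_trans (nrB _ _)) // -(nr_star s).
    by have := iterF m (star s); lra.
  have := nr_starM (star s); rewrite starK nr_star => ->.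
  by rewrite expr2 ler_pM2r.
have SS m : nr (S m) ^+ 2 <= 2 * m%:R.
  rewrite -nr_ip {1}/S ip_suml (le_trans (nr_sum _)) //.
  apply: (@le_trans _ _ (\sum_(i < m) (2 : R))).
    apply: ler_sum => i _; rewrite st_sym ip_st.
    exact: le_trans (iterF _ _) (Sle m).
  by rewrite sumr_const card_ord mulr_natr.
have PZ m : exists2 z, P z & S m = m%:R *: x - th z.
  have PI j : P (iter j st x).
    by elim: j => //= j IH; apply: subspaceB => //; exact: Pth.
  have zj j : exists2 z, P z & iter j st x = x - th z.
    elim: j => [|j [z Pz Hz]].
      exists 0; first exact: subspace0.
      by rewrite /th ip0r act0r subr0.
    exists (z + iter j st x); first exact: subspaceD.
    by rewrite /= {1}/st {1}Hz thD opprD addrA.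
  elim: m => [|m [z Pz Hz]].
    exists 0; first exact: subspace0.
    by rewrite /S big_ord0 /th ip0r act0r subr0 scale0r.
  have [z' Pz' Hz'] := zj m.
  exists (z + z'); first exact: subspaceD.
  by rewrite /S big_ord_recr /= -/(S m) Hz Hz' thD -addn1 natrD scalerDl scale1r; lin.
pose m := (Num.truncn (2 / e ^+ 2)).+1.
have m0 : 0 < m%:R :> R by rewrite ltr0n.
have [z Pz Hz] := PZ m.
exists ((m%:R^-1)%:C *: z); first exact: subspaceZ.
have -> : x - act x (ip x ((m%:R^-1)%:C *: z) : B) = (m%:R^-1)%:C *: S m.
  rewrite Hz ipZr actZr scalerBr -(rmorph_nat (real_complex R)) scalerA -rmorphM.
  by rewrite mulVf ?gt_eqF // rmorph1 scale1r.
rewrite nrZp ?invr_ge0 ?(ltW m0) // -(@ltr_pXn2r _ 2) ?nnegrE ?mulr_ge0 ?invr_ge0 ?nr_ge0 ?(ltW m0) ?(ltW e0) //.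
rewrite exprMn (@le_lt_trans _ _ (m%:R^-1 ^+ 2 * (2 * m%:R))) //.
  by rewrite ler_wpM2l ?sqr_ge0.
have -> : m%:R^-1 ^+ 2 * (2 * m%:R) = 2 / m%:R :> R by field; rewrite gt_eqF.
by rewrite ltr_pdivrMr // mulrC -ltr_pdivrMr ?exprn_gt0 // truncnS_gt.
Qed.

(* [x'] is a polynomial in the operator [y |-> x <x, y>] applied to [x], which
   is why it stays in [P]. *)
Lemma approx_unit x (e : R) (P : set E) : 0 < e ->
  is_subspace P -> P x -> (forall y, P (act x (ip x y : B))) ->
  exists2 x', P x' & nr (x - act x (ip x x' : B)) < e.
Proof.
move=> e0 sP Px Pth.
have [x0|x0] := eqVneq (nr x) 0.
  by exists x => //; rewrite (nr0_eq0 x0) act0l subr0 nr0.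
have {}x0 : 0 < nr x by rewrite lt_def x0 nr_ge0.
set r := nr x in x0; set y := r^-1%:C *: x.
have y1 : nr y <= 1 by rewrite nrZp ?invr_ge0 ?(ltW x0) // mulVf // gt_eqF.
have Pth' z : P (act y (ip y z : B)).
  by rewrite ipZl actZl actZr; do 2! apply: subspaceZ => //.
have Py : P y by apply: subspaceZ.
have [z Pz yz] := approx_unit_le1 y1 (divr_gt0 e0 x0) sP Py Pth'.
exists (r^-1%:C *: z); first exact: subspaceZ.
have xy : x = r%:C *: y by rewrite scalerA -rmorphM /= mulfV ?scale1r // gt_eqF.
have -> : x - act x (ip x (r^-1%:C *: z) : B) = r%:C *: (y - act y (ip y z : B)).
  have rr : r^-1%:C * r%:C = 1 :> R[i] by rewrite -rmorphM /= mulVf ?gt_eqF.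
  rewrite [in LHS]xy ipZr ipZl conj_real [_ *: (_ *: ip y z)]scalerA rr.
  by rewrite scale1r actZl scalerBr.
by rewrite nrZp ?(ltW x0) // mulrC -ltr_pdivlMr.
Qed.

Lemma approx_unitT x (e : R) : 0 < e ->
  exists x', nr (x - act x (ip x x' : B)) < e.
Proof.
by move=> e0; have [||//|x' _] := @approx_unit x e setT e0 => //; exists x'.
Qed.

End ApproximateUnit.

Section TernaryIdeals.
Context {R : realType} {B : cstarAlgType R} {E : hilbertModType B}.
Implicit Types (x y z : E) (a b : B) (K : set E).

Lemma ideal_submodule_ternary K : ideal_submodule K -> closed K /\ ternary_ideal K.
Proof.
case=> I [[_ sI II] cI ->]; set K' := cspan _.
have cK : closed K' by exact: cspan_closed.
have sK : is_subspace K' by exact: cspan_subspace.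
split=> //; split=> // x y z Ky.
have right_span : forall w, K' w -> K' (act x (ip w z : B)).
  pose L : set E := [set w | K' (act x (ip w z : B))].
  apply: (@cspan_sub _ _ _ L).
  - split; first by rewrite /L /= ip0l act0r; exact: (subspace0 sK).
    move=> k u v Lu Lv; rewrite /L /= ipDl ipZl actDr actZr.
    by apply: (subspaceD sK) => //; exact: (subspaceZ sK).
  - move=> w Lw; apply: (closed_approx cK) => e e0.
    pose C := nr x * (4 * nr z) + 1.
    have C0 : 0 < C by rewrite ltr_wpDl // !mulr_ge0 ?nr_ge0.
    have [v Lv wv] := closure_approx Lw (divr_gt0 e0 C0).
    exists (act x (ip v z : B)) => //.
    rewrite -actNr -actDr -ipNl -ipDl (le_lt_trans (nr_act _ _)) //.
    apply: (@le_lt_trans _ _ (C * nr (w - v))); last by rewrite mulrC -ltr_pdivlMr.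
    have := ler_wpM2l (nr_ge0 x) (nr_ip_le (w - v) z).
    have := nr_ge0 (w - v); rewrite /C; nra.
  move=> _ [u [a [_ Ia ->]]]; rewrite /L /= ip_actl.
  apply: (closed_approx cK) => e e0.
  have z1 : 0 < nr (ip u z : B) + 1 by rewrite ltr_wpDl ?nr_ge0.
  have [w xw] := approx_unitT (act x (star a)) (divr_gt0 e0 z1).
  exists (act (act x (star a)) (ip (act x (star a)) w ** ip u z)).
    apply: sub_cspan; exists x, (star a ** (ip (act x (star a)) w ** ip u z)).
    split=> //; last by rewrite [RHS]actA.
    rewrite ip_actl starK -cmulA.
    have [_ Iaw] := II (ip x w ** ip u z) a Logic.I Ia.
    by have [] := II (star a) _ Logic.I Iaw.
  rewrite !actA -actNl -actDl (le_lt_trans (nr_act _ _)) //.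
  apply: (@le_lt_trans _ _ (e / (nr (ip u z : B) + 1) * nr (ip u z : B))).
    by rewrite ler_wpM2r ?nr_ge0 // ltW.
  by rewrite mulrAC ltr_pdivrMr // mulrDr mulr1 ltrDl.
exact: right_span.
Qed.

Lemma ternary_right_module K x a : closed K -> ternary_ideal K -> K x -> K (act x a).
Proof.
move=> cK [sK KK] Kx; apply: (closed_approx cK) => e e0.
have a1 : 0 < nr a + 1 by rewrite ltr_wpDl ?nr_ge0.
have [x' _ xx'] := approx_unit (divr_gt0 e0 a1) sK Kx (fun y => KK x x y Kx).
exists (act x (ip x (act x' a) : B)); first exact: KK.
rewrite ip_act actA -actNl -actDl (le_lt_trans (nr_act _ _)) //.
apply: (@le_lt_trans _ _ (e / (nr a + 1) * nr a)).
  by rewrite ler_wpM2r ?nr_ge0 // ltW.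
by rewrite mulrAC ltr_pdivrMr // mulrDr mulr1 ltrDl.
Qed.

Lemma ternary_ip_ideal K a j : closed K -> ternary_ideal K ->
  cspan (ip_set K K) j -> cspan (ip_set K K) (a ** j) /\ cspan (ip_set K K) (j ** a).
Proof.
move=> cK tK; set I := cspan (ip_set K K).
have sI : is_subspace I by exact: cspan_subspace.
have cI : closed I by exact: cspan_closed.
pose L : set B := [set j | I (a ** j) /\ I (j ** a)].
have a1 : 0 < nr a + 1 by rewrite ltr_wpDl ?nr_ge0.
apply: (@cspan_sub _ _ _ L).
- split; first by rewrite /L /= cmul0l cmul0r; split; exact: (subspace0 sI).
  move=> k u v [Lu1 Lu2] [Lv1 Lv2]; rewrite /L /= !(cmulDl, cmulDr, cmulZl, cmulZr).
  by split; apply: (subspaceD sI) => //; exact: (subspaceZ sI).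
- move=> w Lw; split; apply: (closed_approx cI) => e e0;
    have [v [Lv1 Lv2] wv] := closure_approx Lw (divr_gt0 e0 a1).
    exists (a ** v) => //; rewrite -cmulNr -cmulDr (le_lt_trans (nrM _ _)) //.
    apply: (@le_lt_trans _ _ ((nr a + 1) * nr (w - v))).
      by rewrite ler_wpM2r ?nr_ge0 // lerDl.
    by rewrite mulrC -ltr_pdivlMr.
  exists (v ** a) => //; rewrite -cmulNl -cmulDl (le_lt_trans (nrM _ _)) //.
  apply: (@le_lt_trans _ _ (nr (w - v) * (nr a + 1))).
    by rewrite ler_wpM2l ?nr_ge0 // lerDl.
  by rewrite -ltr_pdivlMr.
move=> _ [x [y [Kx Ky ->]]]; split; apply: sub_cspan.
  exists (act x (star a)), y; split=> //; first exact: ternary_right_module.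
  by rewrite ip_actl starK.
exists x, (act y a); split=> //; first exact: ternary_right_module.
by rewrite ip_act.
Qed.

Lemma ternary_act_cspan K u a : closed K -> ternary_ideal K ->
  cspan (ip_set K K) a -> K (act u a).
Proof.
move=> cK [sK KK] Ia.
pose L : set B := [set j | K (act u j)].
suff : L a by []; apply: cspan_sub Ia.
- split; first by rewrite /L /= act0r; exact: (subspace0 sK).
  move=> k v w Lv Lw; rewrite /L /= actDr actZr.
  by apply: (subspaceD sK) => //; exact: (subspaceZ sK).
- move=> w Lw; apply: (closed_approx cK) => e e0.
  have u1 : 0 < nr u + 1 by rewrite ltr_wpDl ?nr_ge0.
  have [v Lv wv] := closure_approx Lw (divr_gt0 e0 u1).
  exists (act u v) => //; rewrite -actNr -actDr (le_lt_trans (nr_act _ _)) //.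
  apply: (@le_lt_trans _ _ ((nr u + 1) * nr (w - v))).
    by rewrite ler_wpM2r ?nr_ge0 // lerDl.
  by rewrite mulrC -ltr_pdivlMr.
by move=> _ [x' [y [Kx' Ky ->]]]; apply: KK.
Qed.

Lemma ternary_ideal_submodule K : closed K -> ternary_ideal K -> ideal_submodule K.
Proof.
move=> cK tK; have [sK KK] := tK.
exists (cspan (ip_set K K)); split=> //; last 2 first.
- exact: cspan_closed.
- apply/seteqP; split=> x.
    move=> Kx; apply: closed_approx => [|e e0]; first exact: cspan_closed.
    have [x' Kx' xx'] := approx_unit e0 sK Kx (fun y => KK x x y Kx).
    exists (act x (ip x x' : B)) => //; apply: sub_cspan.
    by exists x, (ip x x'); split=> //; apply: sub_cspan; exists x, x'.
  by apply: cspan_sub => // _ [u [a [_ Ia ->]]]; exact: ternary_act_cspan.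
by split=> //; [exact: cspan_subspace|move=> a j _; exact: ternary_ip_ideal].
Qed.

End TernaryIdeals.

Section ModuleNorm.
Context {R : realType} {B : cstarAlgType R} {F : innerProductModType B}.

Record module_norm (p : F -> R) : Prop := {
  mnorm_ge0 : forall u, 0 <= p u;
  mnormD : forall u v, p (u + v) <= p u + p v;
  mnormZ : forall (k : R[i]) u, p (k *: u) = complex.Re `|k| * p u;
  mnorm_act : forall u a, p (act u a) <= p u * nr a;
  mnorm_ip : forall u v, nr (ip u v : B) <= 4 * (p u * p v);
  mnorm_equiv : exists2 C : R, 0 < C & forall u,
    p u <= C * Num.sqrt (nr (ip u u : B)) /\ Num.sqrt (nr (ip u u : B)) <= C * p u
}.

Lemma mod_normE (u : F) : mod_norm u = (Num.sqrt (nr (ip u u : B)))%:C.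
Proof.
rewrite /mod_norm normE -{1}(@sqr_sqrtr _ (nr (ip u u : B))) ?nr_ge0 //.
by rewrite rmorphXn /= sqrCK // ler0c sqrtr_ge0.
Qed.

Variable p : F -> R.
Local Notation rk := (@rank1 R B F).
Hypothesis pP : module_norm p.
Implicit Types (A L : set (F -> F)) (K : set F) (S T : F -> F).

Let p_ge0 := mnorm_ge0 pP.

Lemma mnormN u : p (- u) = p u.
Proof. by rewrite -scaleN1r (mnormZ pP) normrN1 mul1r. Qed.

Lemma mnormB u v : p (u - v) <= p u + p v.
Proof. by rewrite -(mnormN v) (mnormD pP). Qed.

Lemma mnorm0 : p 0 = 0.
Proof. by rewrite -(scale0r (0 : F)) (mnormZ pP) normr0 mul0r. Qed.

Lemma op_closureP A T : op_closure A T <->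
  forall e : R, 0 < e -> exists2 S, A S & forall u, p (T u - S u) <= e * p u.
Proof.
have [C C0 CP] := mnorm_equiv pP.
have C2 : 0 < C ^+ 2 by rewrite exprn_gt0.
have cancel x : C ^+ 2 * (x / C ^+ 2) = x by rewrite mulrC divfK ?gt_eqF.
have le e u v : 0 <= e -> p u <= e * p v ->
    Num.sqrt (nr (ip u u : B)) <= C ^+ 2 * e * Num.sqrt (nr (ip v v : B)).
  move=> e0 uv; have [_ H1] := CP u; apply: (le_trans H1).
  rewrite expr2 -!mulrA ler_pM2l // (le_trans uv) // mulrCA ler_wpM2l //.
  by have [] := CP v.
have ge e u v : 0 <= e ->
    Num.sqrt (nr (ip u u : B)) <= e * Num.sqrt (nr (ip v v : B)) ->
    p u <= C ^+ 2 * e * p v.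
  move=> e0 uv; have [H1 _] := CP u; apply: (le_trans H1).
  rewrite expr2 -!mulrA ler_pM2l // (le_trans uv) // mulrCA ler_wpM2l //.
  by have [] := CP v.
split=> H e e0.
  have ec : 0 < e / C ^+ 2 by rewrite divr_gt0.
  have [S AS ST] := H (e / C ^+ 2)%:C ltac:(by rewrite ltr0C).
  exists S => // u; have := ST u; rewrite !mod_normE -rmorphM lecR => /ge.
  by rewrite cancel; apply; exact: ltW.
have [d d0 ->] := gt0C e0.
have dc : 0 < d / C ^+ 2 by rewrite divr_gt0.
have [S AS ST] := H _ dc.
exists S => // u; have := le _ _ _ (ltW dc) (ST u).
by rewrite cancel !mod_normE -rmorphM lecR.
Qed.

Lemma sub_op_closure A : A `<=` op_closure A.
Proof.
move=> T AT; apply/op_closureP => e e0; exists T => // u.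
by rewrite subrr mnorm0 mulr_ge0 // ltW.
Qed.

Lemma op_closure_mono A A' : A `<=` A' -> op_closure A `<=` op_closure A'.
Proof.
by move=> AA T HT e e0; have [S AS ST] := HT e e0; exists S => //; exact: AA.
Qed.

Lemma op_closure_idem A : op_closure (op_closure A) `<=` op_closure A.
Proof.
move=> T /op_closureP HT; apply/op_closureP => e e0.
have e2 : 0 < e / 2 by rewrite divr_gt0.
have [S /op_closureP AS ST] := HT _ e2; have [S' AS' SS'] := AS _ e2.
exists S' => // u; have -> : T u - S' u = (T u - S u) + (S u - S' u) by lin.
have := ST u; have := SS' u; have := mnormD pP (T u - S u) (S u - S' u); lra.
Qed.

Lemma op_closure_subspace A : is_subspace A -> is_subspace (op_closure A).
Proof.
move=> [A0 AD]; split; first exact: sub_op_closure.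
move=> k S T /op_closureP AS /op_closureP AT; apply/op_closureP => e e0.
set r := complex.Re `|k|.
have r0 : 0 <= r by rewrite -ler0c RRe_real ?ger0_real.
have e1 : 0 < e / 2 / (r + 1) by rewrite !divr_gt0 // ltr_wpDl.
have e2 : 0 < e / 2 by rewrite divr_gt0.
have [S' AS' SS'] := AS _ e1; have [T' AT' TT'] := AT _ e2.
exists (k *: S' + T') => [|u]; first exact: AD.
have -> : (k *: S + T) u - (k *: S' + T') u = k *: (S u - S' u) + (T u - T' u).
  by rewrite !fctE; lin.
apply: (le_trans (mnormD pP _ _)); rewrite (mnormZ pP) -/r.
have : r * p (S u - S' u) <= e / 2 * p u.
  apply: (@le_trans _ _ ((r + 1) * p (S u - S' u))).
    by rewrite ler_wpM2r // lerDl.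
  by rewrite mulrC -ler_pdivlMr ?ltr_wpDl // mulrAC SS'.
have := TT' u; lra.
Qed.

Lemma rank1_cspan_ind K L : is_subspace L -> op_closure L `<=` L ->
  (forall u v, K u -> K v -> L (rk u v)) -> rank1_cspan K `<=` L.
Proof.
move=> sL cL KL T HT; apply: cL; apply: op_closure_mono HT.
by apply: linspan_sub => // _ [u [v [Ku Kv ->]]]; exact: KL.
Qed.

Lemma rank1_cspan_subspace K : is_subspace (rank1_cspan K).
Proof. exact/op_closure_subspace/linspan_subspace. Qed.

Lemma rank1_cspan_closed K : op_closure (rank1_cspan K) `<=` rank1_cspan K.
Proof. exact: op_closure_idem. Qed.

Lemma rank1_cspan_rank1 K u v : K u -> K v -> rank1_cspan K (rk u v).
Proof.
by move=> Ku Kv; apply/sub_op_closure/sub_linspan; exists u, v.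
Qed.

Lemma rank1_cspan_mono K K' : K `<=` K' -> rank1_cspan K `<=` rank1_cspan K'.
Proof.
move=> KK; apply: (rank1_cspan_ind (rank1_cspan_subspace K') (@rank1_cspan_closed K')).
by move=> u v Ku Kv; apply: rank1_cspan_rank1; exact: KK.
Qed.

Lemma mnorm_rank1 u v z : p (rk u v z) <= 4 * (p u * p v) * p z.
Proof.
apply: (le_trans (mnorm_act pP _ _)).
have -> : 4 * (p u * p v) * p z = p u * (4 * (p v * p z)) by ring.
by rewrite ler_wpM2l // (mnorm_ip pP).
Qed.

Lemma rank1_linear u v : linear (rk u v).
Proof. by move=> k x y; rewrite /rank1 ipDr ipZr actDr actZr. Qed.

Lemma rank1Bl u u' v z : rk u v z - rk u' v z = rank1 (u - u') v z.
Proof. by rewrite /rank1 actDl actNl. Qed.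

Lemma rank1Br u v v' z : rk u v z - rk u v' z = rk u (v - v') z.
Proof. by rewrite /rank1 ipDl ipNl actDr actNr. Qed.

Lemma rank1_approxl L u v : op_closure L `<=` L ->
  (forall e : R, 0 < e -> exists2 u', L (rk u' v) & p (u - u') < e) ->
  L (rk u v).
Proof.
move=> cL H; apply: cL; apply/op_closureP => e e0.
have v1 : 0 < 4 * p v + 1 by rewrite ltr_wpDl // mulr_ge0.
have [u' Lu' uu'] := H _ (divr_gt0 e0 v1).
exists (rk u' v) => // z; rewrite rank1Bl (le_trans (mnorm_rank1 _ _ _)) //.
rewrite ler_wpM2r //; move: uu'; rewrite ltr_pdivlMr //.
have := p_ge0 (u - u'); lra.
Qed.

Lemma rank1_approxr L u v : op_closure L `<=` L ->
  (forall e : R, 0 < e -> exists2 v', L (rk u v') & p (v - v') < e) ->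
  L (rk u v).
Proof.
move=> cL H; apply: cL; apply/op_closureP => e e0.
have u1 : 0 < 4 * p u + 1 by rewrite ltr_wpDl // mulr_ge0.
have [v' Lv' vv'] := H _ (divr_gt0 e0 u1).
exists (rk u v') => // z; rewrite rank1Br (le_trans (mnorm_rank1 _ _ _)) //.
rewrite ler_wpM2r //; move: vv'; rewrite ltr_pdivlMr //.
have := p_ge0 (v - v'); lra.
Qed.

Lemma rank1_cspan_bounded K T : rank1_cspan K T ->
  exists2 M : R, 0 <= M & forall u, p (T u) <= M * p u.
Proof.
pose L := [set T : F -> F | exists2 M : R, 0 <= M & forall u, p (T u) <= M * p u].
apply: (@rank1_cspan_ind K L).
- split; first by exists 0 => // u; rewrite mnorm0 mul0r.
  move=> k S U [M M0 HM] [N N0 HN].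
  set r := complex.Re `|k|.
  have r0 : 0 <= r by rewrite -ler0c RRe_real ?ger0_real.
  exists (r * M + N) => [|u]; first by rewrite addr_ge0 ?mulr_ge0.
  rewrite !fctE (le_trans (mnormD pP _ _)) // (mnormZ pP) -/r mulrDl -mulrA.
  by rewrite lerD // ler_wpM2l.
- move=> U /op_closureP/(_ 1 ltr01)[S [M M0 HM] US].
  exists (1 + M) => [|u]; first by rewrite addr_ge0.
  have -> : U u = (U u - S u) + S u by rewrite subrK.
  by rewrite mulrDl (le_trans (mnormD pP _ _)) // lerD.
move=> u v _ _; exists (4 * (p u * p v)); first by rewrite !mulr_ge0.
by move=> z; exact: mnorm_rank1.
Qed.

Lemma rank1_cspan_comp K K' L S T : is_subspace L -> op_closure L `<=` L ->
  (forall u v u' v', K u -> K v -> K' u' -> K' v' ->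
     L (rk u v \o rk u' v')) ->
  rank1_cspan K S -> rank1_cspan K' T -> L (S \o T).
Proof.
move=> sL cL H KS KT.
pose LT := [set S : F -> F | L (S \o T)].
suff : LT S by []; apply: rank1_cspan_ind KS.
- split; first exact: (subspace0 sL).
  by move=> k U V LU LV; apply: sL.2.
- have [M M0 TM] := rank1_cspan_bounded KT.
  have M1 : 0 < M + 1 by rewrite ltr_wpDl.
  move=> U /op_closureP HU; apply: cL; apply/op_closureP => e e0.
  have [V LV UV] := HU _ (divr_gt0 e0 M1).
  exists (V \o T) => // u /=; apply: (le_trans (UV _)).
  apply: (@le_trans _ _ (e / (M + 1) * ((M + 1) * p u))).
    rewrite ler_wpM2l ?divr_ge0 ?(ltW e0) ?(ltW M1) // (le_trans (TM u)) //.
    by rewrite ler_wpM2r // lerDl.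
  by rewrite mulrA divfK // gt_eqF.
move=> u v Ku Kv; pose LS := [set T : F -> F | L (rk u v \o T)].
suff : LS T by []; apply: rank1_cspan_ind KT.
- have lin0 : rk u v \o (0 : F -> F) = 0.
    by apply/funext => z; rewrite /= /rank1 ip0r act0r.
  split; first by rewrite /LS /= lin0; exact: (subspace0 sL).
  move=> k U V LU LV; have linD : rk u v \o (k *: U + V) = k *: (rk u v \o U) + (rk u v \o V).
    by apply/funext => z; rewrite /= rank1_linear.
  by rewrite /LS /= linD; apply: sL.2.
- move=> U /op_closureP HU; apply: cL; apply/op_closureP => e e0.
  pose c := 4 * (p u * p v).
  have c0 : 0 <= c by rewrite !mulr_ge0.
  have c1 : 0 < c + 1 by rewrite ltr_wpDl.
  have [V LV UV] := HU _ (divr_gt0 e0 c1).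
  exists (rk u v \o V) => // z /=.
  have -> : rk u v (U z) - rk u v (V z) = rk u v (U z - V z).
    by rewrite /rank1 ipDr ipNr actDr actNr.
  apply: (le_trans (mnorm_rank1 _ _ _)); rewrite -/c.
  apply: (@le_trans _ _ ((c + 1) * p (U z - V z))).
    by rewrite ler_wpM2r // lerDl.
  by rewrite mulrC -ler_pdivlMr // mulrAC.
by move=> u' v' Ku' Kv'; exact: H.
Qed.

End ModuleNorm.

Lemma hilbert_module_norm (R : realType) (B : cstarAlgType R) (E : hilbertModType B) :
  module_norm (F := E) (@nr R E).
Proof.
split; [exact: nr_ge0|exact: nrD|exact: nrZ|exact: nr_act|exact: nr_ip_le|].
by exists 1 => // u; rewrite nr_ip sqrtr_sqr ger0_norm ?nr_ge0 // mul1r lexx.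
Qed.

Section RangeSum.
Context {R : realType} {B : cstarAlgType R} {E : hilbertModType B}.
Local Notation F := (range_sum E).
Implicit Types (x y z : E) (b c : range_ideal E) (k : E -> E) (u v : F).

Definition sum_norm u : R := nr (val u.1 : B) + nr u.2.

Lemma sum_norm_fst u : nr (val u.1 : B) <= sum_norm u.
Proof. by rewrite lerDl nr_ge0. Qed.

Lemma sum_norm_snd u : nr u.2 <= sum_norm u.
Proof. by rewrite lerDr nr_ge0. Qed.

Lemma sum_module_norm : module_norm sum_norm.
Proof.
split.
- by move=> u; rewrite addr_ge0 ?nr_ge0.
- by move=> u v; rewrite /sum_norm raddfD addrACA lerD ?nrD.
- by move=> k u; rewrite /sum_norm linearZ /= !nrZ mulrDr.
- by move=> u a; rewrite /sum_norm /= mulrDl lerD ?nrM ?nr_act.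
- move=> u v; rewrite (le_trans (nrD _ _)) //.
  have := nrM (star (val u.1)) (val v.1); rewrite nr_star.
  have := nr_ip_le u.2 v.2; rewrite /sum_norm.
  have := nr_ge0 (val u.1 : B); have := nr_ge0 (val v.1 : B).
  have := nr_ge0 u.2; have := nr_ge0 v.2; nra.
have K0 : 1 <= expR 2 :> R by rewrite -expR0 ler_expR.
exists (2 * expR 2) => [|u]; first by rewrite mulr_gt0 ?expR_gt0.
set s := nr (ip u u : B); set K : R := expR 2 in K0 *.
have [c hc] := ip_pos u.2.
have sE : s = nr (star (val u.1) ** val u.1 + star c ** c : B) by rewrite /s -hc.
have s0 : 0 <= s by exact: nr_ge0.
have leK t : 0 <= t -> t ^+ 2 <= K * s -> t <= K * Num.sqrt s.
  move=> t0 ts; have Ks : 0 <= K * Num.sqrt s by rewrite mulr_ge0 ?sqrtr_ge0 ?expR_ge0.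
  rewrite -(@ler_pXn2r _ 2) ?nnegrE // exprMn sqr_sqrtr // (le_trans ts) //.
  by rewrite ler_wpM2r // expr2 ler_peMl // expR_ge0.
split.
  have := leK _ (nr_ge0 (val u.1 : B)); rewrite sE => /(_ (starM_le _ _)).
  have := leK _ (nr_ge0 u.2).
  have -> : nr u.2 ^+ 2 = nr c ^+ 2 by rewrite -nr_ip hc nr_starM.
  rewrite {1}sE addrC => /(_ (starM_le _ _)).
  rewrite addrC -sE /sum_norm; lra.
have := @ler_wsqrtr R s (sum_norm u ^+ 2); rewrite sqrtr_sqr ger0_norm ?addr_ge0 ?nr_ge0 //.
have le : s <= sum_norm u ^+ 2.
  rewrite /s (le_trans (nrD _ _)) // nr_starM nr_ip /sum_norm sqrrD.
  by rewrite lerD2r lerDl mulrn_wge0 // mulr_ge0 ?nr_ge0.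
move=> /(_ le) /le_trans; apply.
rewrite ler_peMl ?addr_ge0 ?nr_ge0 //; lra.
Qed.

Lemma range_sum_eq u v : val u.1 = val v.1 :> B -> u.2 = v.2 -> u = v.
Proof. by case: u v => [a x] [b y] /= /val_inj -> ->. Qed.

Lemma range_ideal_ex (b : B) : range_set E b -> exists c : range_ideal E, val c = b.
Proof. by move=> rb; exists (Sub b (introT (asboolP _) rb)). Qed.

Lemma range_idealP c : range_set E (val c).
Proof. exact/asboolP/(valP c). Qed.

Lemma block_opD b x y k b' x' y' k' (t : R[i]) :
  t *: block_op b x y k + block_op b' x' y' k' =
  block_op (t *: b + b') (Num.conj t *: x + x') (t *: y + y') (t *: k + k').
Proof.
apply/funext => u; apply: range_sum_eq.
  have -> : val ((t *: block_op b x y k + block_op b' x' y' k') u).1 =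
      t *: val (block_op b x y k u).1 + val (block_op b' x' y' k' u).1 :> B by [].
  rewrite /= !raddfD /= ?linearZ /= cmulDl cmulZl ipDl ipZl conjCK; lin.
have -> : ((t *: block_op b x y k + block_op b' x' y' k') u).2 =
    t *: (block_op b x y k u).2 + (block_op b' x' y' k' u).2 by [].
have kE : (t *: k + k') u.2 = t *: k u.2 + k' u.2 by [].
rewrite /= kE actDl actZl; lin.
Qed.

Lemma rank1_sumE u v : rank1 u v =
  block_op (range_mul u.1 (star (val v.1))) (act v.2 (star (val u.1)))
    (act u.2 (star (val v.1))) (rank1 u.2 v.2).
Proof.
apply/funext => w; apply: range_sum_eq; rewrite /rank1 /= /sum_ip.
  by rewrite !cmulDr cmulA ip_actl starK.
by rewrite actDr actA.
Qed.

Lemma sum_norm_block b x y k (r s t m : R) u :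
  nr (val b : B) <= r -> nr x <= s -> nr y <= t -> 0 <= m ->
  (forall z, nr (k z) <= m * nr z) ->
  sum_norm (block_op b x y k u) <= (r + 4 * s + t + m) * sum_norm u.
Proof.
move=> br xs yt m0 km; set n1 := nr (val u.1 : B); set n2 := nr u.2.
have n10 : 0 <= n1 by exact: nr_ge0.
have n20 : 0 <= n2 by exact: nr_ge0.
have b0 := nr_ge0 (val b : B); have x0 := nr_ge0 x; have y0 := nr_ge0 y.
have H1 : nr (val (block_op b x y k u).1 : B) <= r * n1 + 4 * s * n2.
  rewrite /= (le_trans (nrD _ _)) // lerD //.
    by rewrite (le_trans (nrM _ _)) // ler_wpM2r.
  by rewrite (le_trans (nr_ip_le _ _)) // mulrA ler_wpM2r // ler_pM2l.
have H2 : nr (block_op b x y k u).2 <= t * n1 + m * n2.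
  rewrite /= (le_trans (nrD _ _)) // lerD //.
  by rewrite (le_trans (nr_act _ _)) // ler_wpM2r.
rewrite /sum_norm -/n1 -/n2; nra.
Qed.

Lemma cspan_star (A : set B) (b' : B) : (forall a, A a -> A (star a)) ->
  cspan A b' -> cspan A (star b').
Proof.
move=> AA; have sA := cspan_subspace A; pose L : set B := [set a | cspan A (star a)].
apply: (@cspan_sub _ _ _ L); last by move=> a /AA; exact: sub_cspan.
  split; first by rewrite /L /= star0; exact: (subspace0 sA).
  move=> k v w Lv Lw; rewrite /L /= starD starZ.
  by apply: (subspaceD sA) => //; exact: (subspaceZ sA).
move=> w Lw; apply: (closed_approx (@cspan_closed _ _ A)) => e e0.
have [v Lv wv] := closure_approx Lw e0.
by exists (star v) => //; rewrite -starN -starD nr_star.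
Qed.

Lemma block_norm_bound b x y k (e : R) : 0 <= e ->
  (forall u, sum_norm (block_op b x y k u) <= e * sum_norm u) ->
  [/\ nr (val b : B) <= e, nr x <= e, nr y <= 4 * e & forall z, nr (k z) <= e * nr z].
Proof.
move=> e0 H.
have sum1 (a : range_ideal E) : sum_norm (a, 0) = nr (val a : B).
  by rewrite /sum_norm /= nr0 addr0.
have sum2 z : sum_norm (0, z) = nr z by rewrite /sum_norm /= nr0 add0r.
have Hb (a : range_ideal E) : nr (val b ** val a : B) <= e * nr (val a : B).
  rewrite -(sum1 a); apply: le_trans (H _); apply: le_trans (sum_norm_fst _).
  by rewrite /= ip0r addr0.
have Hx z : nr (ip x z : B) <= e * nr z.
  rewrite -(sum2 z); apply: le_trans (H _); apply: le_trans (sum_norm_fst _).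
  by rewrite /= cmul0r add0r.
have Hk z : nr (k z) <= e * nr z.
  rewrite -(sum2 z); apply: le_trans (H _); apply: le_trans (sum_norm_snd _).
  by rewrite /= act0r add0r.
have k00 : k 0 = 0.
  have := Hk 0; rewrite nr0 mulr0 => k0.
  by apply/nr0_eq0/le_anti; rewrite k0 nr_ge0.
have Hy (a : range_ideal E) : nr (act y (val a : B)) <= e * nr (val a : B).
  rewrite -(sum1 a); apply: le_trans (H _); apply: le_trans (sum_norm_snd _).
  by rewrite /= k00 addr0.
have cancel (s t : R) : 0 <= s -> s ^+ 2 <= t * s -> s <= t \/ s = 0.
  rewrite le_eqVlt => /predU1P[<-|s0]; first by right.
  by rewrite expr2 ler_pM2r //; left.
split=> //.
- have [b' Hb'] : exists b' : range_ideal E, val b' = star (val b).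
    apply: range_ideal_ex.
    apply: (@cspan_star (ip_set [set: E] [set: E])); last exact: range_idealP.
    by move=> _ [v [w [_ _ ->]]]; exists w, v; rewrite ip_star.
  have := Hb b'; rewrite Hb' nr_star -{1}(starK (val b)) nr_starM nr_star.
  by case/(cancel _ _ (nr_ge0 _)) => // ->.
- have := Hx x; rewrite nr_ip.
  by case/(cancel _ _ (nr_ge0 _)) => // ->.
have := Hy (range_ip y y); have := nr_ip_le y (act y (ip y y : B)).
rewrite /= ip_act -{1}[ip y y]ip_star nr_starM !nr_ip => H1 H2.
have [y0|y0] := eqVneq (nr y) 0; first by rewrite y0 mulr_ge0.
have {}y0 : 0 < nr y by rewrite lt_def y0 nr_ge0.
have y3 : 0 < nr y ^+ 3 by rewrite exprn_gt0.
rewrite -(ler_pM2r y3).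
have -> : nr y * nr y ^+ 3 = (nr y ^+ 2) ^+ 2 by ring.
apply: (le_trans H1).
have -> : 4 * e * nr y ^+ 3 = 4 * (nr y * (e * nr y ^+ 2)) by ring.
by rewrite ler_pM2l // ler_wpM2l // nr_ge0.
Qed.

End RangeSum.

Section TernaryLinking.
Context {R : realType} {B : cstarAlgType R} {E : hilbertModType B}.
Local Notation F := (range_sum E).
Local Notation rk := (@rank1 R B E).
Local Notation rkF := (@rank1 R B F).
Implicit Types (x y z : E) (a : B) (b c : range_ideal E) (k : E -> E) (u v : F).

Lemma rank1_actr (G : innerProductModType B) (u v : G) a :
  rank1 u (act v a) = rank1 (act u (star a)) v.
Proof. by apply/funext => z; rewrite /rank1 ip_actl actA. Qed.

Lemma block_opB b x y k b' x' y' k' u :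
  block_op b x y k u - block_op b' x' y' k' u =
  block_op (b - b') (x - x') (y - y') (fun z => k z - k' z) u.
Proof.
apply: range_sum_eq; rewrite /=.
  by rewrite !(cmulDl, cmulNl, ipDl, ipNl); lin.
by rewrite actDl actNl; lin.
Qed.

Lemma block_split b x y k : block_op b x y k =
  block_op b 0 0 0 + (block_op 0 x 0 0 + (block_op 0 0 y 0 + block_op 0 0 0 k)).
Proof.
apply/funext => u; apply: range_sum_eq.
  have D (S T : F -> F) w : val ((S + T) w).1 = val (S w).1 + val (T w).1 :> B by [].
  by rewrite !D /= !(cmul0l, ip0l, addr0, add0r).
have D (S T : F -> F) w : ((S + T) w).2 = (S w).2 + (T w).2 by [].
by rewrite !D /= !(act0l, addr0, add0r).
Qed.

Lemma block_op0 : block_op (0 : range_ideal E) 0 0 (0 : E -> E) = 0.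
Proof.
apply/funext => u; apply: range_sum_eq; rewrite /=.
  by rewrite cmul0l ip0l addr0.
by rewrite act0l addr0.
Qed.

Lemma block_approx (L : set (F -> F)) b x y k : op_closure L `<=` L ->
  (forall e : R, 0 < e -> exists b' x' y' k',
    [/\ L (block_op b' x' y' k'), nr (val b - val b' : B) <= e,
        nr (x - x') <= e, nr (y - y') <= e
      & forall z, nr (k z - k' z) <= e * nr z]) ->
  L (block_op b x y k).
Proof.
move=> cL H; apply: cL; apply/(op_closureP sum_module_norm) => e e0.
have e7 : 0 < e / 7 by rewrite divr_gt0.
have [b' [x' [y' [k' [L' bb xx yy kk]]]]] := H _ e7.
exists (block_op b' x' y' k') => // u; rewrite block_opB.
have -> : e = e / 7 + 4 * (e / 7) + e / 7 + e / 7 by field.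
by apply: sum_norm_block => //; exact: ltW.
Qed.

Variable K : set E.
Hypotheses (cK : closed K) (tK : ternary_ideal K).
Local Notation I := (cspan (ip_set K K)).
Let sK : is_subspace K := tK.1.

Let sI : is_subspace I. Proof. exact: cspan_subspace. Qed.
Let cI : closed I. Proof. exact: cspan_closed. Qed.

Let I_star a : I a -> I (star a).
Proof.
by apply: cspan_star => _ [x [y [Kx Ky ->]]]; exists y, x; rewrite ip_star.
Qed.

Lemma ternary_approx x (e : R) : K x -> 0 < e ->
  exists2 x', K x' & nr (x - act x (ip x x' : B)) < e.
Proof. by move=> Kx e0; apply: approx_unit => // y; apply: tK.2. Qed.

Lemma ternary_ipl x y : K x -> I (ip x y).
Proof.
move=> Kx; apply: (closed_approx cI) => e e0.
have y1 : 0 < 4 * nr y + 1 by rewrite ltr_wpDl // mulr_ge0 ?nr_ge0.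
have [x' Kx' xx'] := ternary_approx Kx (divr_gt0 e0 y1).
exists (ip (act x (ip x x' : B)) y).
  rewrite ip_actl ip_star -ip_act.
  by apply: sub_cspan; exists x', (act x (ip x y : B)); split=> //; exact: tK.2.
rewrite -ipNl -ipDl (le_lt_trans (nr_ip_le _ _)) //.
move: xx'; rewrite ltr_pdivlMr //; set t := nr (x - _); have := nr_ge0 (x - act x (ip x x' : B)); rewrite -/t.
by move=> ? ?; lra.
Qed.

Lemma ternary_ipr x y : K y -> I (ip x y).
Proof. by move=> Ky; rewrite -ip_star; exact/I_star/ternary_ipl. Qed.

Lemma ternary_rank1l x y : K x -> rank1_cspan K (rk x y).
Proof.
move=> Kx; apply: (rank1_approxl (hilbert_module_norm E)).
  exact: (rank1_cspan_closed (hilbert_module_norm E)).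
move=> e e0; have [x' Kx' xx'] := ternary_approx Kx e0.
exists (act x (ip x x' : B)) => //.
rewrite -[ip x x']ip_star -rank1_actr.
apply: (rank1_cspan_rank1 (hilbert_module_norm E)) => //.
by apply: ternary_act_cspan => //; exact: ternary_ipr.
Qed.

Lemma ternary_rank1r x y : K y -> rank1_cspan K (rk x y).
Proof.
move=> Ky; apply: (rank1_approxr (hilbert_module_norm E)).
  exact: (rank1_cspan_closed (hilbert_module_norm E)).
move=> e e0; have [y' Ky' yy'] := ternary_approx Ky e0.
exists (act y (ip y y' : B)) => //; rewrite rank1_actr.
apply: (rank1_cspan_rank1 (hilbert_module_norm E)) => //.
by rewrite ip_star; apply: ternary_act_cspan => //; exact: ternary_ipr.
Qed.

Lemma linking_set_subspace : is_subspace (linking_set K).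
Proof.
have sC := rank1_cspan_subspace (hilbert_module_norm E) K.
split.
  exists 0, 0, 0, 0; split; rewrite ?block_op0 //; try exact: (subspace0 sK).
    exact: (subspace0 sI).
  exact: (subspace0 sC).
move=> t _ _ [b [x [y [k [Ib Kx Ky Ck ->]]]]] [b' [x' [y' [k' [Ib' Kx' Ky' Ck' ->]]]]].
rewrite block_opD; do 4! eexists; split; last by [].
- by rewrite raddfD /=; exact: sI.2.
- exact: sK.2.
- exact: sK.2.
- exact: sC.2.
Qed.

Definition linking_gen : set F := [set u | I (val u.1) /\ K u.2].

Lemma linking_set_rank1 u v : linking_gen u \/ linking_gen v ->
  linking_set K (rkF u v).
Proof.
have act_I x a : I a -> K (act x a) by exact: ternary_act_cspan.
have K_act x a : K x -> K (act x a) by exact: ternary_right_module.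
rewrite rank1_sumE => -[[Iu Ku]|[Iv Kv]]; (do 4! eexists; split; last by []).
- exact: (ternary_ip_ideal (star (val v.1)) cK tK Iu).2.
- exact/act_I/I_star.
- exact: K_act.
- exact: ternary_rank1l.
- exact: (ternary_ip_ideal (val u.1) cK tK (I_star Iv)).1.
- exact: K_act.
- exact/act_I/I_star.
- exact: ternary_rank1r.
Qed.

Lemma linking_set_sub : linking_set K `<=` rank1_cspan linking_gen.
Proof.
have sM := rank1_cspan_subspace sum_module_norm linking_gen.
have cM := rank1_cspan_closed (K := linking_gen) sum_module_norm.
have I0 : I (val (0 : range_ideal E)) by exact: (subspace0 sI).
have K0 : K 0 by exact: (subspace0 sK).
have gen u v T : linking_gen u -> linking_gen v -> rkF u v = T ->
    rank1_cspan linking_gen T.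
  by move=> Hu Hv <-; apply: (rank1_cspan_rank1 sum_module_norm).
have rk0l z : rk 0 z = 0 by apply/funext => w; rewrite /rank1 act0l.
have rk0r z : rk z 0 = 0 by apply/funext => w; rewrite /rank1 ip0l act0r.
move=> _ [b [x [y [k [Ib Kx Ky Ck ->]]]]]; rewrite block_split.
apply: (subspaceD sM); last apply: (subspaceD sM); last apply: (subspaceD sM).
- pose L : set B := [set a | exists2 b : range_ideal E, val b = a &
      rank1_cspan linking_gen (block_op b 0 0 0)].
  suff [b' /val_inj ->] : L (val b) by [].
  apply: cspan_sub Ib.
  + split; first by exists 0 => //; rewrite block_op0; exact: (subspace0 sM).
    move=> t _ _ [c <- Lc] [d <- Ld]; exists (t *: c + d); first by rewrite raddfD.
    have := sM.2 t _ _ Lc Ld; rewrite block_opD.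
    by rewrite !scaler0 !addr0.
  + move=> a La; have [c Hc] : exists c : range_ideal E, val c = a.
      apply: range_ideal_ex; apply: (@cspan_closed _ _ (ip_set setT setT)).
      by apply: closureS La => _ [c <- _]; exact: range_idealP.
    exists c => //; apply: block_approx => // e e0.
    have [_ [d <- Ld] ad] := closure_approx La e0.
    exists d, 0, 0, 0; split=> //; rewrite ?subrr ?nr0 ?(ltW e0) //.
      by rewrite Hc ltW.
    by move=> z; rewrite subrr nr0 mulr_ge0 ?nr_ge0 // ltW.
  move=> _ [z [w [Kz Kw ->]]].
  exists (range_ip z w) => //; apply: block_approx => // e e0.
  have z1 : 0 < 4 * nr z + 1 by rewrite ltr_wpDl // mulr_ge0 ?nr_ge0.
  have [w' Kw' ww'] := ternary_approx Kw (divr_gt0 e0 z1).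
  exists (range_mul (range_ip z w) (ip w w' : B)), 0, 0, 0.
  split=> //; rewrite ?subrr ?nr0 ?(ltW e0) //.
  + apply: (gen (range_ip z w, 0) (range_ip w' w, 0)).
    * by split=> //=; exact: ternary_ipl.
    * by split=> //=; exact: ternary_ipl.
    by rewrite rank1_sumE /= ip_star !act0l rk0l.
  + rewrite /= -ip_act -ipNr -ipDr (le_trans (nr_ip_le _ _)) //.
    move: ww'; rewrite ltr_pdivlMr //; have := nr_ge0 (w - act w (ip w w' : B)); lra.
  by move=> ?; rewrite subrr nr0 mulr_ge0 ?nr_ge0 // ltW.
- apply: block_approx => // e e0.
  have [x' Kx' xx'] := ternary_approx Kx e0.
  exists 0, (act x (ip x x' : B)), 0, 0.
  split=> //; rewrite ?subrr ?nr0 ?(ltW e0) ?(ltW xx') //; last first.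
    by move=> ?; rewrite subrr nr0 mulr_ge0 ?nr_ge0 // ltW.
  apply: (gen (range_ip x' x, 0) (0, x)).
  + by split=> //=; exact: ternary_ipl.
  + by split.
  rewrite rank1_sumE /= ip_star star0 !act0l rk0l; congr block_op.
  by apply: val_inj; rewrite /= cmul0r.
- apply: block_approx => // e e0.
  have [y' Ky' yy'] := ternary_approx Ky e0.
  exists 0, 0, (act y (ip y y' : B)), 0.
  split=> //; rewrite ?subrr ?nr0 ?(ltW e0) ?(ltW yy') //; last first.
    by move=> ?; rewrite subrr nr0 mulr_ge0 ?nr_ge0 // ltW.
  apply: (gen (0, y) (range_ip y' y, 0)).
  + by split.
  + by split=> //=; exact: ternary_ipl.
  rewrite rank1_sumE /= ip_star !act0l rk0r; congr block_op.
  by apply: val_inj; rewrite /= cmul0l.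
pose L : set (E -> E) := [set k | rank1_cspan linking_gen (block_op 0 0 0 k)].
suff /(_ k Ck) : rank1_cspan K `<=` L by [].
apply: (@rank1_cspan_ind _ _ E K L).
- split; first by rewrite /L /= block_op0; exact: (subspace0 sM).
  move=> t f g Lf Lg; have := sM.2 t _ _ Lf Lg; rewrite block_opD.
  by rewrite !scaler0 !addr0.
- move=> f /(op_closureP (hilbert_module_norm E)) Hf; apply: block_approx => // e e0.
  have [g Lg fg] := Hf _ e0.
  exists 0, 0, 0, g; split=> //; rewrite ?subrr ?nr0 ?(ltW e0) //.
move=> z w Kz Kw; apply: (gen (0, z) (0, w)); try by split.
rewrite rank1_sumE /= star0 !act0r; congr block_op.
by apply: val_inj; rewrite /= cmul0l.
Qed.

End TernaryLinking.

Section Completeness.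
Context {R : realType}.

Lemma harmonic_small (C e : R) : 0 <= C -> 0 < e -> exists n, C / n.+1%:R < e.
Proof.
move=> C0 e0; exists (Num.truncn (C / e)).
by rewrite ltr_pdivrMr // mulrC -ltr_pdivrMr // truncnS_gt.
Qed.

Lemma complete_limit (V : completeNormedModType R[i]) (v : nat -> V) (C : R) :
  0 <= C -> (forall m n, nr (v m - v n) <= C * (m.+1%:R^-1 + n.+1%:R^-1)) ->
  exists l, forall n, nr (l - v n) <= C / n.+1%:R.
Proof.
move=> C0 H.
have cv : cvg (v @ \oo).
  apply/cauchy_cvgP/cauchy_ballP => _ /gt0C[e e0 ->].
  have [N HN] : exists N, C / N.+1%:R < e / 2 by apply: harmonic_small; rewrite ?divr_gt0.
  have small n : (N <= n)%N -> C / n.+1%:R < e / 2.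
    by move=> Nn; apply: le_lt_trans HN; rewrite ler_wpM2l // lef_pV2 ?posrE // ler_nat.
  exists (v @` [set n | (N <= n)%N], v @` [set n | (N <= n)%N]).
    by split; exists N => // n Nn; exists n.
  move=> [_ _] [[m Nm <-] [n Nn <-]].
  rewrite -ball_normE /= normE ltcR (le_lt_trans (H m n)) //.
  by rewrite mulrDr [e]splitr ltrD // small.
exists (lim (v @ \oo)) => n.
apply: (@le_addeM _ _ _ 2 1) => // e e0 _.
have /cvgrPdist_lt/(_ e%:C) := cv.
rewrite ltr0C => /(_ e0)[N _ HN].
have [M HM] := harmonic_small C0 e0.
pose m := maxn N M.
have := HN m (leq_maxl _ _); rewrite /= normE ltcR => lm.
have mM : C / m.+1%:R <= C / M.+1%:R.
  by rewrite ler_wpM2l // lef_pV2 ?posrE // ler_nat ltnS leq_maxr.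
have -> : lim (v @ \oo) - v n = (lim (v @ \oo) - v m) + (v m - v n) by lin.
apply: (le_trans (nrD _ _)); have := H m n; rewrite mulrDr.
move: (C / m.+1%:R) (C / n.+1%:R) (C / M.+1%:R) mM HM => p q t; lra.
Qed.

End Completeness.

Section LinkingIdeal.
Context {R : realType} {B : cstarAlgType R} {E : hilbertModType B}.
Local Notation F := (range_sum E).
Implicit Types (x y z : E) (k : E -> E).

Variable K : set E.
Hypotheses (cK : closed K) (tK : ternary_ideal K).

Lemma linking_set_closed : op_closure (linking_set K) `<=` linking_set K.
Proof.
move=> T /(op_closureP sum_module_norm) HT.
pose r n : R := n.+1%:R^-1.
have r0 n : 0 < r n by rewrite invr_gt0.
have seq n : exists s : range_ideal E * E * E * (E -> E),
    [/\ cspan (ip_set K K) (val s.1.1.1), K s.1.1.2, K s.1.2, rank1_cspan K s.2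
      & forall u, sum_norm (T u - block_op s.1.1.1 s.1.1.2 s.1.2 s.2 u) <= r n * sum_norm u].
  have [_ [b [x [y [k [Ib Kx Ky Ck ->]]]]] ST] := HT _ (r0 n).
  by exists (b, x, y, k).
have {seq} [s Hs] := choice seq.
pose b n := (s n).1.1.1; pose x n := (s n).1.1.2; pose y n := (s n).1.2; pose k n := (s n).2.
have diff m n : [/\ nr (val (b m - b n) : B) <= r m + r n, nr (x m - x n) <= r m + r n,
    nr (y m - y n) <= 4 * (r m + r n) & forall z, nr (k m z - k n z) <= (r m + r n) * nr z].
  apply: block_norm_bound; first by rewrite addr_ge0 // ltW.
  move=> u; rewrite -block_opB.
  have [_ _ _ _ /(_ u) Hm] := Hs m; have [_ _ _ _ /(_ u) Hn] := Hs n.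
  rewrite -/(b m) -/(x m) -/(y m) -/(k m) in Hm.
  rewrite -/(b n) -/(x n) -/(y n) -/(k n) in Hn.
  set Sm := block_op (b m) _ _ _ u in Hm *; set Sn := block_op (b n) _ _ _ u in Hn *.
  have -> : Sm - Sn = (T u - Sn) - (T u - Sm) by lin.
  by rewrite (le_trans (mnormB sum_module_norm _ _)) // mulrDl addrC lerD.
have [b' Hb] : exists l, forall n, nr (l - val (b n) : B) <= 1 / n.+1%:R.
  apply: complete_limit => // m n; have [+ _ _ _] := diff m n.
  by rewrite mul1r raddfB.
have [x' Hx] : exists l, forall n, nr (l - x n) <= 1 / n.+1%:R.
  by apply: complete_limit => // m n; have [_ + _ _] := diff m n; rewrite mul1r.
have [y' Hy] : exists l, forall n, nr (l - y n) <= 4 / n.+1%:R.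
  by apply: complete_limit => // m n; have [_ _ + _] := diff m n.
have kex z : exists l, forall n, nr (l - k n z) <= nr z / n.+1%:R.
  apply: complete_limit => [|m n]; first exact: nr_ge0.
  by have [_ _ _ /(_ z)] := diff m n; rewrite mulrC.
have {kex} [k' Hk] := choice kex.
have close (V : completeNormedModType R[i]) (A : set V) (f : nat -> V) l (C : R) :
    0 <= C -> closed A -> (forall n, A (f n)) -> (forall n, nr (l - f n) <= C / n.+1%:R) -> A l.
  move=> C0 cA Af lf; apply: (closed_approx cA) => e e0.
  have [n Hn] := harmonic_small C0 e0.
  by exists (f n) => //; exact: le_lt_trans (lf n) Hn.
have Ib' : cspan (ip_set K K) b'.
  apply: (close _ _ (fun n => val (b n)) _ 1) Hb => //; first exact: cspan_closed.
  by move=> n; have [] := Hs n.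
have [c Hc] : exists c : range_ideal E, val c = b'.
  apply: range_ideal_ex; apply: (close _ _ (fun n => val (b n)) _ 1) Hb => //.
    exact: cspan_closed.
  by move=> n; exact: range_idealP.
have Kx' : K x' by apply: (close _ _ x _ 1) Hx => // n; have [] := Hs n.
have Ky' : K y' by apply: (close _ _ y _ 4) Hy => // n; have [] := Hs n.
have Ck' : rank1_cspan K k'.
  apply: (rank1_cspan_closed (hilbert_module_norm E)).
  apply/(op_closureP (hilbert_module_norm E)) => e e0.
  have [n Hn] := harmonic_small ler01 e0.
  exists (k n) => [|z]; first by have [] := Hs n.
  rewrite (le_trans (Hk z n)) // mulrC ler_wpM2r ?nr_ge0 // -[_^-1]mul1r.
  exact: ltW.
exists c, x', y', k'; split=> //; first by rewrite Hc.
apply/funext => u; apply/eqP; rewrite -subr_eq0; apply/eqP.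
have : sum_norm (T u - block_op c x' y' k' u) = 0.
  apply/le_anti/andP; split; last exact: (mnorm_ge0 sum_module_norm).
  set M := sum_norm u.
  have M0 : 0 <= M by exact: (mnorm_ge0 sum_module_norm).
  apply: (@le_addeM _ _ _ 1 1) => // e e0 _; rewrite add0r mul1r.
  have [n /ltW Hn] := harmonic_small (mulr_ge0 (ler0n R 11) M0) e0.
  apply: le_trans Hn.
  set Sn := block_op (b n) (x n) (y n) (k n) u.
  have -> : T u - block_op c x' y' k' u = (T u - Sn) - (block_op c x' y' k' u - Sn) by lin.
  rewrite (le_trans (mnormB sum_module_norm _ _)) //.
  have H1 : sum_norm (T u - Sn) <= r n * M by have [_ _ _ _ /(_ u)] := Hs n.
  have H2 : sum_norm (block_op c x' y' k' u - Sn) <=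
      (r n + 4 * r n + 4 * r n + r n) * M.
    rewrite block_opB; apply: sum_norm_block.
    - have -> : val (c - b n) = b' - val (b n) :> B by rewrite -Hc.
      by rewrite (le_trans (Hb n)) // mul1r.
    - by rewrite (le_trans (Hx n)) // mul1r.
    - exact: Hy.
    - exact: ltW.
    by move=> z; rewrite (le_trans (Hk z n)) // mulrC.
  by rewrite mulrAC -/(r n); lra.
set w := T u - _ => w0.
have w1 := sum_norm_fst w; have w2 := sum_norm_snd w; rewrite w0 in w1 w2.
apply: range_sum_eq; apply: nr0_eq0; apply/le_anti; rewrite nr_ge0 andbT.
  exact: w1.
exact: w2.
Qed.

Lemma ternary_linking_ideal : linking_ideal K.
Proof.
have cL := linking_set_closed.
have sL := linking_set_subspace tK.
have LN := linking_set_sub tK.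
split=> //.
  move=> T /LN; apply: (rank1_cspan_mono sum_module_norm); exact: subsetT.
have NR u a : linking_gen K u -> linking_gen K (act u a).
  move=> [Iu Ku]; split; last exact: ternary_right_module.
  exact: (ternary_ip_ideal a cK tK Iu).2.
move=> S T alg_S /LN gen_T; split.
  apply: (rank1_cspan_comp sum_module_norm sL cL _ alg_S gen_T).
  move=> u v u' v' _ _ _ Nv'; rewrite rank1_ip.
  by apply: linking_set_rank1 => //; right.
apply: (rank1_cspan_comp sum_module_norm sL cL _ gen_T alg_S).
move=> u v u' v' Nu _ _ _; rewrite rank1_ip.
by apply: linking_set_rank1 => //; left; exact: NR.
Qed.

End LinkingIdeal.

Section LinkingToTernary.
Context {R : realType} {B : cstarAlgType R} {E : hilbertModType B}.
Local Notation F := (range_sum E).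
Local Notation rkF := (@rank1 R B F).
Implicit Types (x y z : E) (b c : range_ideal E) (k : E -> E).

Lemma block_op_inj b x y k b' x' y' k' :
  block_op b x y k = block_op b' x' y' k' -> x = x' /\ y = y'.
Proof.
move=> eqb; have [_ + + _] : [/\ nr (val (b - b') : B) <= 0, nr (x - x') <= 0,
    nr (y - y') <= 4 * 0 & forall z, nr (k z - k' z) <= 0 * nr z].
  apply: block_norm_bound => // u.
  by rewrite -block_opB eqb subrr (mnorm0 sum_module_norm) mul0r.
have zero z : nr z <= 0 -> z = 0.
  by move=> z0; apply/nr0_eq0/le_anti; rewrite z0 nr_ge0.
by rewrite mulr0 => /zero/subr0_eq -> /zero/subr0_eq ->.
Qed.

Lemma linking_ideal_ternary (K : set E) : closed K -> linking_ideal K -> ternary_ideal K.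
Proof.
move=> cK [_ sL LA].
have corner b x y k : linking_set K (block_op b x y k) -> K x /\ K y.
  by move=> [b' [x' [y' [k' [_ Kx Ky _ /block_op_inj[-> ->]]]]]].
have I0 : cspan (ip_set K K) (val (0 : range_ideal E)).
  exact: (subspace0 (cspan_subspace _)).
have C0 : rank1_cspan K 0.
  exact: (subspace0 (rank1_cspan_subspace (hilbert_module_norm E) K)).
have K0 : K 0.
  by have := subspace0 sL; rewrite -block_op0 => /corner[].
have Lrow x : K x -> linking_set K (block_op 0 x 0 0).
  by move=> Kx; exists 0, x, 0, 0.
have Lcol y : K y -> linking_set K (block_op 0 0 y 0).
  by move=> Ky; exists 0, 0, y, 0.
have alg z c : linking_algebra (rkF (0, z) (c, 0)).
  exact: (rank1_cspan_rank1 sum_module_norm).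
have algE z c u : rkF (0, z) (c, 0) u = (0, act (act z (star (val c))) (val u.1 : B)).
  rewrite rank1_sumE; apply: range_sum_eq; rewrite /=.
    by rewrite !cmul0l act0l ip0l addr0.
  by rewrite /rank1 ip0l act0r addr0.
split.
  split=> // t x y Kx Ky; have := sL.2 t _ _ (Lcol _ Kx) (Lcol _ Ky).
  by rewrite block_opD => /corner[].
move=> x y z Ky.
have step x' z' : K (act (act x (ip x x' : B)) (ip y (act z (ip z z' : B)) : B)).
  have [_ LT] := LA _ _ (alg z (range_ip z' z)) (Lrow _ Ky).
  have [+ _] := LA _ _ (alg x (range_ip x' x)) LT.
  set S := _ \o _.
  have -> : S = block_op 0 0
      (act (act x (ip x x' : B)) (ip y (act z (ip z z' : B)) : B)) 0.
    apply/funext => u; rewrite /S /= !algE; apply: range_sum_eq; rewrite /=.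
      by rewrite cmul0l ip0l addr0.
    by rewrite !ip_star cmul0l add0r ip_act actA addr0.
  by case/corner.
have half x' : K (act (act x (ip x x' : B)) (ip y z : B)).
  set w := act x _; apply: (closed_approx cK) => e e0.
  have C1 : 0 < nr w * (4 * nr y) + 1 by rewrite ltr_wpDl // !mulr_ge0 ?nr_ge0.
  have [z' zz'] := approx_unitT z (divr_gt0 e0 C1).
  exists (act w (ip y (act z (ip z z' : B)) : B)); first exact: step.
  rewrite -actNr -actDr -ipNr -ipDr (le_lt_trans (nr_act _ _)) //.
  rewrite ltr_pdivlMr // in zz'; apply: le_lt_trans zz'.
  have := ler_wpM2l (nr_ge0 w) (nr_ip_le y (z - act z (ip z z' : B))).
  have := nr_ge0 (z - act z (ip z z' : B)); lra.
apply: (closed_approx cK) => e e0.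
have C1 : 0 < nr (ip y z : B) + 1 by rewrite ltr_wpDl ?nr_ge0.
have [x' xx'] := approx_unitT x (divr_gt0 e0 C1).
exists (act (act x (ip x x' : B)) (ip y z : B)) => //.
rewrite -actNl -actDl (le_lt_trans (nr_act _ _)) //.
rewrite ltr_pdivlMr // in xx'; apply: le_lt_trans xx'.
by rewrite ler_wpM2l ?nr_ge0 // lerDl.
Qed.

End LinkingToTernary.

Theorem theorem2p2 (R : realType) (B : cstarAlgType R) (E : hilbertModType B)
    (K : set E) :
  (ideal_submodule K <-> closed K /\ ternary_ideal K) /\
  (closed K /\ ternary_ideal K <-> closed K /\ linking_ideal K).
Proof.
split; split.
- exact: ideal_submodule_ternary.
- by case=> cK tK; exact: ternary_ideal_submodule.
- by case=> cK tK; split=> //; exact: ternary_linking_ideal.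
- by case=> cK lK; split=> //; exact: linking_ideal_ternary.
Qed.
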